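(* Let $\mathcal{A}$ be a homogeneous constant-coefficient differential operator on $\mathbb{R}^N$ acting on $\mathbb{R}^d$-valued functions, satisfying the constant rank property and the spanning property, and let $\mathcal{B}$ be a potential of $\mathcal{A}$. Suppose that $\mathcal{B}$ is of order one. Then a function $f\colon\mathbb{R}^d\to\mathbb{R}$ is $\mathcal{A}$-quasiaffine if and only if $f$ is $\Lambda_{\mathcal{A}}$-affine, i.e. for all $v\in\mathbb{R}^d$ and all $w\in\Lambda_{\mathcal{A}}=\bigcup_{\xi\in\mathbb{R}^N\setminus\{0\}}\ker\mathcal{A}[\xi]$ the map $t\mapsto f(v+tw)$ is affine on $\mathbb{R}$.
   Context: $\mathcal{A}\colon C^\infty(\mathbb{R}^N,\mathbb{R}^d)\to C^\infty(\mathbb{R}^N,\mathbb{R}^l)$ is given by $\mathcal{A}u=\sum_{|\alpha|=k_{\mathcal{A}}}A_\alpha\partial_\alpha u$ with constant coefficients $A_\alpha\in\mathrm{Lin}(\mathbb{R}^d,\mathbb{R}^l)$. Its Fourier symbol is $\mathcal{A}[\xi]=\sum_{|\alpha|=k_{\mathcal{A}}}\xi^\alpha A_\alpha$, $\xi\in\mathbb{R}^N\setminus\{0\}$. Constant rank property: $\dim\ker\mathcal{A}[\xi]$ is the same for all $\xi\in\mathbb{R}^N\setminus\{0\}$. Spanning property: $\Lambda_{\mathcal{A}}$ spans $\mathbb{R}^d$. A potential of $\mathcal{A}$ is a homogeneous constant-coefficient differential operator $\mathcal{B}\colon C^\infty(\mathbb{R}^N,\mathbb{R}^m)\to C^\infty(\mathbb{R}^N,\mathbb{R}^d)$,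 $\mathcal{B}u=\sum_{|\alpha|=k_{\mathcal{B}}}B_\alpha\partial_\alpha u$, of order $k_{\mathcal{B}}$, whose symbol $\mathcal{B}[\xi]=\sum_{|\alpha|=k_{\mathcal{B}}}\xi^\alpha B_\alpha$ satisfies $\mathrm{Im}\,\mathcal{B}[\xi]=\ker\mathcal{A}[\xi]$ for all $\xi\in\mathbb{R}^N\setminus\{0\}$. $T_N$ is the $N$-torus, $[0,1]^N$ with the usual identification of faces. A function $f\colon\mathbb{R}^d\to\mathbb{R}$ is $\mathcal{A}$-quasiaffine if it is continuous and $f(v)=\int_{T_N}f(v+\psi(y))\,dy$ for all $v\in\mathbb{R}^d$ and all $\psi\in C^\infty(T_N,\mathbb{R}^d)$ with $\mathcal{A}\psi=0$ and $\int_{T_N}\psi=0$. *)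

(* Defs.v *)
From HB Require Import structures.
From mathcomp Require Import all_boot all_order all_algebra.
From mathcomp Require Import all_classical all_reals all_analysis.

Set Implicit Arguments.
Unset Strict Implicit.
Unset Printing Implicit Defensive.

Import Order.TTheory GRing.Theory Num.Theory.
Import numFieldNormedType.Exports.

Local Open Scope classical_set_scope.
Local Open Scope ring_scope.

(* Vectors of R^n are row vectors, and a matrix M : 'M[R]_(p, q) represents   *)
(* the linear map u |-> u *m M from R^p to R^q. Thus the kernel of this map   *)
(* is the row space of kermx M, and its image is the row space of M.          *)

Section partial_derivatives.
Context {R : realType} {N d : nat}.
Implicit Types u : 'rV[R]_N -> 'rV[R]_d.

Definition partial (i : 'I_N) u : 'rV[R]_N -> 'rV[R]_d :=
  fun x => 'D_(delta_mx 0 i) u x.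

Definition smooth u : Prop :=
  forall s : seq 'I_N,
    continuous (foldr partial u s) /\
    forall (i : 'I_N) (x : 'rV[R]_N),
      derivable (foldr partial u s) x (delta_mx 0 i).

Definition periodic u : Prop :=
  forall (i : 'I_N) (x : 'rV[R]_N), u (x + delta_mx 0 i) = u x.

End partial_derivatives.

Section multi_indices.
Context {N k : nat}.

(* The entries of a multi-index of length k are at most k, so that this       *)
(* finite type contains all multi-indices of length k.                        *)
Definition mindex : finType := {ffun 'I_N -> 'I_k.+1}.

Definition mlength (a : mindex) : nat := (\sum_i a i)%N.

Definition mpartial {R : realType} {d : nat} (a : mindex)
    (u : 'rV[R]_N -> 'rV[R]_d) : 'rV[R]_N -> 'rV[R]_d :=
  foldr (fun i v => iter (a i) (partial i) v) u (enum 'I_N).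

Definition mmonom {R : realType} (a : mindex) (xi : 'rV[R]_N) : R :=
  \prod_i xi 0 i ^+ a i.

End multi_indices.
Arguments mindex : clear implicits.

(* A homogeneous constant-coefficient operator on R^N, mapping R^d-valued     *)
(* functions to R^l-valued ones. Only the coefficients of the multi-indices   *)
(* of length [op_order] are ever used.                                        *)
Record diffop (R : realType) (N d l : nat) := DiffOp {
  op_order : nat;
  op_coef : mindex N op_order -> 'M[R]_(d, l)
}.

Section operators.
Context {R : realType} {N d l : nat}.
Implicit Types A : diffop R N d l.

Definition apply_op A (u : 'rV[R]_N -> 'rV[R]_d) : 'rV[R]_N -> 'rV[R]_l :=
  fun x => \sum_(a : mindex N (op_order A) | mlength a == op_order A)
             mpartial a u x *m op_coef a.

Definition symbol A (xi : 'rV[R]_N) : 'M[R]_(d, l) :=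
  \sum_(a : mindex N (op_order A) | mlength a == op_order A)
     mmonom a xi *: op_coef a.

Definition constant_rank A : Prop :=
  forall xi eta : 'rV[R]_N, xi != 0 -> eta != 0 ->
    \rank (kermx (symbol A xi)) = \rank (kermx (symbol A eta)).

Definition wave_cone A : set 'rV[R]_d :=
  \bigcup_(xi in [set xi : 'rV[R]_N | xi != 0])
     [set w | (w <= kermx (symbol A xi))%MS].

Definition spanning A : Prop :=
  forall v : 'rV[R]_d, exists (n : nat) (c : 'I_n -> R) (w : 'I_n -> 'rV[R]_d),
    (forall i, wave_cone A (w i)) /\ v = \sum_i c i *: w i.

End operators.

Definition potential {R : realType} {N d l m : nat}
    (A : diffop R N d l) (B : diffop R N m d) : Prop :=
  forall xi : 'rV[R]_N, xi != 0 -> (symbol B xi == kermx (symbol A xi))%MS.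

Section torus_measure.
Context {R : realType}.

(* Lebesgue measure restricted to [0, 1] *)
Definition lebesgue01 :=
  mrestr (@lebesgue_measure R) (measurable_itv `[0%R, 1%R]).

HB.instance Definition _ := Measure.on lebesgue01.

Let lebesgue01_setT : lebesgue01 setT = 1%E.
Proof.
rewrite /lebesgue01 /mrestr setTI lebesgue_measure_itv /= lte_fin ltr01.
by rewrite oppr0 adde0.
Qed.

HB.instance Definition _ :=
  Measure_isProbability.Build _ _ R lebesgue01 lebesgue01_setT.

Definition tcons n (p : measurableTypeR R * n.-tuple (measurableTypeR R)) :
  n.+1.-tuple (measurableTypeR R) := [tuple of p.1 :: p.2].

Let measurable_tcons n : measurable_fun setT (@tcons n).
Proof. exact: (measurable_cons measurable_fst measurable_snd). Qed.

HB.instance Definition _ n :=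
  isMeasurableFun.Build _ _ _ _ (@tcons n) (@measurable_tcons n).

(* Lebesgue measure on [0, 1]^n, as the n-fold product measure; the           *)
(* identified faces are negligible, so that this is the measure of the torus. *)
Fixpoint torus_measure n : probability (n.-tuple (measurableTypeR R)) R :=
  match n with
  | 0 => \d_([tuple] : 0.-tuple (measurableTypeR R))
  | n'.+1 => distribution (lebesgue01 \x torus_measure n')%E (@tcons n')
  end.

Definition torus_integral N (g : 'rV[R]_N -> R) : R :=
  \int[torus_measure N]_y g (\row_i tnth y i).

End torus_measure.

Section quasiaffine.
Context {R : realType} {N d l : nat}.
Implicit Types (A : diffop R N d l) (f : 'rV[R]_d -> R).

Definition quasiaffine A f : Prop :=
  continuous f /\
  forall (v : 'rV[R]_d) (psi : 'rV[R]_N -> 'rV[R]_d),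
    smooth psi -> periodic psi ->
    (forall x, apply_op A psi x = 0) ->
    (forall j, torus_integral (fun y => psi y 0 j) = 0) ->
    f v = torus_integral (fun y => f (v + psi y)).

Definition cone_affine A f : Prop :=
  forall v w : 'rV[R]_d, wave_cone A w ->
    exists a b : R, forall t : R, f (v + t *: w) = a * t + b.

End quasiaffine.

(* Main.v *)
(* If [f] is quasiaffine, test it with [psi y = cos (2 pi q.y) r w], where [q] is
   integral and [w] lies in [ker A[q]]: then [g t = f (v + t w)] satisfies
   [g c = int g (c + r cos)], so it is affine by the maximum principle. A general
   element of the cone is [u B[xi]], a limit of multiples of such [w] because
   integral directions are dense and [B] is linear in [xi].

   Conversely, the Fejer means of an admissible [psi] converge uniformly to [psi] and
   are trigonometric polynomials whose amplitudes at frequency [q] lie in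
   [ker A[q] = Im B[q]], so [psi] may be taken to be such a polynomial. Its waves are
   removed one at a time with [f (z + c w) = f z + c D_w f z]. Since [f] is affine on
   the translates of [Im B[q]], [D_w f] is invariant along [Im B[q]], and the point is
   that [int (wave of frequency q) * h (v + psi) = 0] when [q <> 0] and [h] is affine
   along the cone and invariant along [Im B[q]]. Indeed a wave of [psi] whose
   frequency [q'] also leaves [h] invariant is irrelevant, while any other one produces
   the frequencies [q + q'] and [q - q']: they are nonzero and leave [D_w' h]
   invariant, because the frequencies leaving a function invariant form a linear
   space, [B] being linear. *)

From HB Require Import structures.
Require Import Defs.
From mathcomp Require Import all_boot all_order all_algebra.
From mathcomp Require Import all_classical all_reals all_analysis.
From mathcomp Require Import measurable_realfun.
From mathcomp Require Import ring lra.

Set Implicit Arguments.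
Unset Strict Implicit.
Unset Printing Implicit Defensive.

Import Order.TTheory GRing.Theory Num.Theory.
Import numFieldNormedType.Exports.

Local Open Scope classical_set_scope.
Local Open Scope ring_scope.

(** * Continuity and convergence in spaces of matrices *)

Lemma mx_norm_le {R : realType} m n (x : 'M[R]_(m, n)) (e : R) :
  0 <= e -> (forall i j, `|x i j| <= e) -> `|x| <= e.
Proof.
move=> e0 xe; rewrite /Num.Def.normr/= mx_normrE.
by apply: bigmax_le => // -[i j] _; exact: xe.
Qed.

Lemma le_mx_norm {R : realType} m n (x : 'M[R]_(m, n)) i j : `|x i j| <= `|x|.
Proof.
rewrite [leRHS]/Num.Def.normr/= mx_normrE.
exact: (le_bigmax _ (fun ij => `|x ij.1 ij.2|) (i, j)).
Qed.

Lemma cvg_mx {R : realType} m n T (F : set_system T) (FF : Filter F)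
    (f : T -> 'M[R]_(m, n)) (l : 'M[R]_(m, n)) :
  (forall i j, f x i j @[x --> F] --> l i j) -> f x @[x --> F] --> l.
Proof.
move=> fl; apply/cvgrPdist_le => e e0.
have : \forall x \near F, forall ij : 'I_m * 'I_n, `|l ij.1 ij.2 - f x ij.1 ij.2| <= e.
  apply: filter_forall => ij; exact: ((cvgrPdist_le _ _).1 (fl ij.1 ij.2) _ e0).
apply: filterS => x fx; apply: mx_norm_le => [|i j]; first exact: ltW.
by rewrite !mxE; exact: (fx (i, j)).
Qed.

Lemma continuous_mx {R : realType} m n (T : topologicalType)
    (f : T -> 'M[R]_(m, n)) :
  (forall i j, continuous (fun x => f x i j)) -> continuous f.
Proof. by move=> cf x; apply: cvg_mx => i j; exact: cf. Qed.

(** Rounding down to the grid of mesh [1 / n.+1]. It serves twice: to prove measurability of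
    continuous functions, and to approximate a direction by multiples of integral ones. *)
Definition floor_approx {R : realType} n N (x : 'rV[R]_N) : 'rV[R]_N :=
  \row_i ((Num.floor (x 0 i * n.+1%:R))%:~R / n.+1%:R).

Lemma cvg_floor_approx {R : realType} N (x : 'rV[R]_N) :
  floor_approx n x @[n --> \oo] --> x.
Proof.
apply: cvg_mx => i j; apply/cvgrPdist_le => e e0; near=> n.
rewrite !mxE ord1; set t := x 0 j.
have n0 : 0 < n.+1%:R :> R by rewrite ltr0n.
have := floor_itv (t * n.+1%:R); rewrite intrD => /andP[].
rewrite -ler_pdivrMr// -ltr_pdivlMr// mulrDl mul1r => h1 h2.
rewrite ger0_norm ?subr_ge0//.
apply: (@le_trans _ _ n.+1%:R^-1); first by rewrite lerBlDl ltW.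
by apply: ltW; near: n; exact: near_infty_natSinv_lt (PosNum e0).
Unshelve. all: by end_near. Qed.

Lemma continuousT_comp (S T U : topologicalType) (f : S -> T) (g : T -> U) :
  continuous f -> continuous g -> continuous (fun x => g (f x)).
Proof. by move=> cf cg x; apply: continuous_comp; [exact: cf|exact: cg]. Qed.

Lemma continuousTM {R : realType} (T : topologicalType) (f g : T -> R) :
  continuous f -> continuous g -> continuous (fun x => f x * g x).
Proof. by move=> cf cg x; apply: cvgM; [exact: cf|exact: cg]. Qed.

Lemma continuousTD {R : realType} (V : normedModType R) (T : topologicalType)
    (f g : T -> V) :
  continuous f -> continuous g -> continuous (fun x => f x + g x).
Proof. by move=> cf cg x; apply: cvgD; [exact: cf|exact: cg]. Qed.

Lemma continuousTN {R : realType} (V : normedModType R) (T : topologicalType)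
    (f : T -> V) : continuous f -> continuous (fun x => - f x).
Proof. by move=> cf x; apply: cvgN; exact: cf. Qed.

Lemma continuousTZ {R : realType} (V : normedModType R) (T : topologicalType)
    (f : T -> R) (g : T -> V) :
  continuous f -> continuous g -> continuous (fun x => f x *: g x).
Proof. by move=> cf cg x; apply: cvgZ; [exact: cf|exact: cg]. Qed.

Lemma continuous_bigsum {R : realType} (T : topologicalType) (I : Type)
    (r : seq I) (P : pred I) (g : I -> T -> R) : (forall i, continuous (g i)) ->
  continuous (fun x => \sum_(i <- r | P i) g i x).
Proof.
move=> cg; elim: r => [|i r IH].
  rewrite (_ : (fun _ => _) = cst 0); first exact: cst_continuous.
  by apply/funext => x; rewrite big_nil.
rewrite (_ : (fun _ => _) = fun x =>
  (if P i then g i x else 0) + \sum_(i <- r | P i) g i x); last first.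
  by apply/funext => x; rewrite big_cons; case: ifP; rewrite ?add0r.
move=> x; apply: cvgD (IH x); case: ifP => _; [exact: cg|exact: cvg_cst].
Qed.

(** * The torus integral *)

Section torus.
Context {R : realType}.
Local Notation tup n := (n.-tuple (measurableTypeR R)).
Local Notation row_of y := (\row_i tnth y i).
Local Notation leb01 := (@lebesgue01 R).
Local Notation tm := (@torus_measure R).

(** The value depends only on the integer vector of floors, so a preimage is a countable union of
    cells, each a finite intersection of slabs given by half-open intervals. *)
Let measurable_floor_approx n N (g : 'rV[R]_N -> R) :
  measurable_fun setT (fun y : tup N => g (floor_approx n (row_of y))).
Proof.
move=> _ Y mY; rewrite setTI.
pose pt (c : {ffun 'I_N -> int}) : 'rV[R]_N := \row_i ((c i)%:~R / n.+1%:R).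
pose cell (c : {ffun 'I_N -> int}) : set (tup N) :=
  [set y | forall i, Num.floor (tnth y i * n.+1%:R) = c i].
rewrite (_ : _ @^-1` _ = \bigcup_c (if g (pt c) \in Y then cell c else set0)).
  apply: countable_bigcupT_measurable; first exact: countableP.
  move=> c; case: ifP => // _.
  rewrite (_ : cell c = \bigcap_(i in setT)
      ((@tnth N _)^~ i @^-1` [set t | Num.floor (t * n.+1%:R) = c i])); last first.
    by apply/seteqP; split=> [y yc i _|y yc i]; [exact: yc|exact: yc].
  apply: fin_bigcap_measurable => // i _.
  rewrite -[_ @^-1` _]setTI; apply: measurable_tnth => //.
  rewrite (_ : [set _ | _] = `[(c i)%:~R / n.+1%:R, (c i + 1)%:~R / n.+1%:R[%classic).
    exact: measurable_itv.
  have n0 : 0 < n.+1%:R :> R by rewrite ltr0n.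
  apply/seteqP; split=> [t /= tc|t /=]; rewrite in_itv/= ler_pdivrMr// ltr_pdivlMr//.
    by rewrite -tc floor_itv.
  by move=> ?; apply/eqP; rewrite floor_eq.
apply/seteqP; split=> [y /= gy|y [c _]].
  exists [ffun i => Num.floor (tnth y i * n.+1%:R)] => //.
  rewrite (_ : pt _ = floor_approx n (row_of y)); last first.
    by apply/rowP => i; rewrite !mxE ffunE.
  by rewrite mem_set// => i; rewrite ffunE.
case: ifPn => // /set_mem /= gc yc; rewrite (_ : floor_approx n (row_of y) = pt c)//.
by apply/rowP => i; rewrite !mxE yc.
Qed.

(* [g] is the pointwise limit of its values at the points of finer and finer grids. *)
Lemma measurable_row N (g : 'rV[R]_N -> R) : continuous g ->
  measurable_fun setT (fun y : tup N => g (row_of y)).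
Proof.
move=> cg; apply: (@measurable_fun_cvg _ _ _ _
  (fun n y => g (floor_approx n (row_of y)))).
  by move=> n; exact: measurable_floor_approx.
by move=> y _; apply: cvg_comp (@cvg_floor_approx R N (row_of y)) (cg _).
Qed.

(** The torus measure is defined on all tuples but concentrated on this compact set, so
    integrability and inequalities need only be examined here. *)
Definition cube N : set 'rV[R]_N := [set x | forall i, 0 <= x 0 i <= 1].

Let tcube N : set (tup N) := [set y | cube (row_of y)].

Let measurable_tcube N : measurable (@tcube N).
Proof.
rewrite (_ : @tcube N = \bigcap_(i in setT)
    ((@tnth N _)^~ i @^-1` `[0, 1]%classic)).
  apply: fin_bigcap_measurable => // i _.
  by rewrite -[_ @^-1` _]setTI; apply: measurable_tnth => //; exact: measurable_itv.
apply/seteqP; split=> [y yc i _|y yc i] /=.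
  by have := yc i; rewrite mxE in_itv.
by have := yc i I; rewrite mxE /= in_itv.
Qed.

Let torus_measure_cube N : tm N (@tcube N) = 1%E.
Proof.
elim: N => [|n IH].
  rewrite (_ : @tcube 0 = setT) ?probability_setT//.
  by apply/seteqP; split=> // y _ [].
transitivity ((leb01 \x tm n)%E (`[0, 1]%classic `*` @tcube n)).
  congr ((leb01 \x tm n)%E _); apply/seteqP; split=> -[s y] /=.
    move=> yc; split=> [|i]; first by have := yc ord0; rewrite mxE in_itv.
    by have := yc (lift ord0 i); rewrite !mxE tnthS.
  rewrite in_itv/= => -[s01 yc] i; rewrite mxE.
  case: (unliftP ord0 i) => [j ->|->]; last by [].
  by rewrite tnthS; have := yc j; rewrite mxE.
transitivity (leb01 `[0%R, 1%R]%classic * tm n (@tcube n))%E.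
  by apply: product_measure1E; [exact: measurable_itv|exact: measurable_tcube].
rewrite IH mule1 /lebesgue01/= /mrestr setIid.
by rewrite lebesgue_measure_itv /= lte_fin ltr01 oppr0 adde0.
Qed.

Let torus_measure_cubeC N : tm N (~` @tcube N) = 0%E.
Proof.
rewrite probability_setC; last exact: measurable_tcube.
by rewrite [X in (_ - X)%E](torus_measure_cube N) subee.
Qed.

Lemma cube_compact N : compact (@cube N).
Proof.
have : compact [set v : 'rV[R]_N | forall i, v ord0 i \in `[(0 : R), 1]].
  apply: (@rV_compact _ _ (fun=> `[(0 : R), 1]%classic)).
  by move=> _; exact: segment_compact.
by congr compact; apply/seteqP; split=> x /= x01 i; have := x01 i; rewrite in_itv.
Qed.

Lemma integrable_torus N (g : 'rV[R]_N -> R) : continuous g ->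
  (tm N).-integrable setT (fun y => (g (row_of y))%:E).
Proof.
move=> cg; have mg := measurable_row cg.
have mC : measurable (~` @tcube N) by apply: measurableC; exact: measurable_tcube.
apply/(negligible_integrable mC) => //.
- exact/measurable_EFinP.
- exact: torus_measure_cubeC.
rewrite setDE setTI setCK.
apply: (@measurable_bounded_integrable _ _ _ (tm N) (fun y => g (row_of y))) => //.
- exact: measurable_tcube.
- by rewrite [X in (X < _)%E](torus_measure_cube N) ltry.
- exact: measurable_funTS.
have /compact_bounded [M [Mr gM]] : compact (g @` @cube N).
  by apply: continuous_compact (@cube_compact N); exact: continuous_subspaceT.
by exists M; split => // x xM y yc; apply: (gM _ xM); exists (row_of y).
Qed.

Let torus_integralE N (g : 'rV[R]_N -> R) : continuous g ->
  torus_integral g = \int[tm N]_(y in @tcube N) g (row_of y).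
Proof.
move=> cg; rewrite /torus_integral /Rintegral.
rewrite (negligible_integral _ _ (integrable_torus cg) (torus_measure_cubeC N))//.
  by rewrite setDE setTI setCK.
by apply: measurableC; exact: measurable_tcube.
Qed.

Lemma torus_integralD N (g h : 'rV[R]_N -> R) : continuous g -> continuous h ->
  torus_integral (fun y => g y + h y) = torus_integral g + torus_integral h.
Proof. by move=> cg ch; apply: RintegralD => //; exact: integrable_torus. Qed.

Lemma torus_integralZ N (a : R) (g : 'rV[R]_N -> R) : continuous g ->
  torus_integral (fun y => a * g y) = a * torus_integral g.
Proof. by move=> cg; apply: RintegralZl => //; exact: integrable_torus. Qed.

Lemma torus_integral_cst N (a : R) : torus_integral (fun _ : 'rV[R]_N => a) = a.
Proof.
by rewrite /torus_integral Rintegral_cst// [X in fine X]probability_setT mulr1.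
Qed.

Lemma le_torus_integral N (g h : 'rV[R]_N -> R) :
  continuous g -> continuous h -> (forall x, cube x -> g x <= h x) ->
  torus_integral g <= torus_integral h.
Proof.
move=> cg ch gh; rewrite !torus_integralE//; apply: le_Rintegral.
- exact: measurable_tcube.
- apply: (integrableS _ _ _ (integrable_torus cg)) => //; exact: measurable_tcube.
- apply: (integrableS _ _ _ (integrable_torus ch)) => //; exact: measurable_tcube.
- by move=> y yc; exact: gh.
Qed.

Lemma torus_integralN N (g : 'rV[R]_N -> R) : continuous g ->
  torus_integral (fun y => - g y) = - torus_integral g.
Proof.
move=> cg; rewrite -mulN1r -torus_integralZ//.
by congr torus_integral; apply/funext => y; rewrite mulN1r.
Qed.

Lemma ler_norm_torus_integral N (g h : 'rV[R]_N -> R) :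
  continuous g -> continuous h -> (forall x, cube x -> `|g x| <= h x) ->
  `|torus_integral g| <= torus_integral h.
Proof.
move=> cg ch gh; rewrite ler_norml lerNl -torus_integralN//.
apply/andP; split; apply: le_torus_integral => //.
- by move=> x; apply: continuousN; exact: cg.
- by move=> x /gh; rewrite ler_norml lerNl => /andP[].
- by move=> x /gh; rewrite ler_norml => /andP[].
Qed.

Lemma torus_integral_sum N (I : Type) (r : seq I) (P : pred I)
    (g : I -> 'rV[R]_N -> R) : (forall i, continuous (g i)) ->
  torus_integral (fun y => \sum_(i <- r | P i) g i y) =
  \sum_(i <- r | P i) torus_integral (g i).
Proof.
move=> cg; elim: r => [|i r IH].
  rewrite big_nil -[RHS](torus_integral_cst N); congr torus_integral.
  by apply/funext => y; rewrite big_nil.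
rewrite big_cons -IH; case: ifPn => Pi; last first.
  by congr torus_integral; apply/funext => y; rewrite big_cons (negbTE Pi).
rewrite -torus_integralD//; last first.
  exact: continuous_bigsum.
by congr torus_integral; apply/funext => y; rewrite big_cons Pi.
Qed.

(** * Integration one coordinate at a time *)

Definition row_cons n (s : R) (x : 'rV[R]_n) : 'rV[R]_n.+1 :=
  \row_i (if unlift ord0 i is Some j then x 0 j else s).

Lemma row_cons0 n s (x : 'rV[R]_n) : row_cons s x 0 ord0 = s.
Proof. by rewrite mxE unlift_none. Qed.

Lemma row_consS n s (x : 'rV[R]_n) j : row_cons s x 0 (lift ord0 j) = x 0 j.
Proof. by rewrite mxE liftK. Qed.

Lemma continuous_row_consr n s : continuous (@row_cons n s).
Proof.
apply: continuous_mx => i j; case: (unliftP ord0 j) => [k ->|->]; rewrite ord1.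
  rewrite (_ : (fun _ => _) = fun x : 'rV[R]_n => x 0 k).
    exact: coord_continuous.
  by apply/funext => x; rewrite row_consS.
rewrite (_ : (fun _ => _) = fun=> s); first exact: cst_continuous.
by apply/funext => x; rewrite row_cons0.
Qed.

Lemma continuous_row_consl n (x : 'rV[R]_n) : continuous (fun s => row_cons s x).
Proof.
apply: continuous_mx => i j; case: (unliftP ord0 j) => [k ->|->]; rewrite ord1.
  rewrite (_ : (fun _ => _) = fun=> x 0 k); first exact: cst_continuous.
  by apply/funext => s; rewrite row_consS.
rewrite (_ : (fun _ => _) = id); first by move=> t; exact: cvg_id.
by apply/funext => s; rewrite row_cons0.
Qed.

Let integral_lebesgue01 (h : R -> R) : continuous h ->
  leb01.-integrable setT (EFin \o h) /\
  (\int[leb01]_s (h s)%:E = \int[lebesgue_measure]_(s in `[0%R, 1%R]) (h s)%:E)%E.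
Proof.
move=> ch; pose I01 : set (measurableTypeR R) := `[0%R, 1%R]%classic.
have mI : measurable I01 by exact: measurable_itv.
have mCI : measurable (~` I01) by exact: measurableC.
have I0 : leb01 (~` I01) = 0%E.
  by rewrite /lebesgue01/= /mrestr setICl measure0.
have mh : measurable_fun [set: measurableTypeR R] h.
  exact: continuous_measurable_fun.
have ih : leb01.-integrable setT (EFin \o h).
  apply/(negligible_integrable mCI) => //.
    by apply/measurable_EFinP.
  rewrite setDE setTI setCK; apply: measurable_bounded_integrable => //.
  - by rewrite ltey_eq fin_num_measure.
  - exact: measurable_funTS.
  have /compact_bounded [M [Mr hM]] : compact (h @` I01).
    apply: continuous_compact; last exact: segment_compact.
    exact: continuous_subspaceT.
  by exists M; split => // x xM y yc; apply: (hM _ xM); exists y.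
split=> //; rewrite (negligible_integral _ _ ih I0)//.
rewrite setDE setTI setCK; apply: eq_measure_integral => A mA AI.
by rewrite /= /lebesgue01 /mrestr setIidl.
Qed.

Lemma lebesgue01_FTC (h : R -> R) (dh : R -> R) :
  (forall s, is_derive s (1 : R) h (dh s)) -> continuous dh ->
  \int[leb01]_s dh s = h 1 - h 0.
Proof.
move=> hdh cdh; have ch : continuous h.
  move=> s; apply: differentiable_continuous; apply/derivable1_diffP.
  by have [] := hdh s.
rewrite /Rintegral (integral_lebesgue01 cdh).2.
rewrite (@continuous_FTC2 _ dh h)//.
- exact: continuous_subspaceT.
- split; first by move=> x _; have [] := hdh x.
  + by apply: cvg_at_right_filter; exact: ch.
  + by apply: cvg_at_left_filter; exact: ch.
- by move=> x _; rewrite derive1E; have [] := hdh x.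
Qed.

Lemma row_tcons n (p : measurableTypeR R * tup n) :
  row_of (tcons p) = row_cons p.1 (row_of p.2) :> 'rV[R]_n.+1.
Proof.
apply/rowP => i; rewrite !mxE; case: unliftP => [j ->|->] //.
by rewrite tnthS mxE.
Qed.

Let integrable_tcons n (g : 'rV[R]_n.+1 -> R) : continuous g ->
  (leb01 \x tm n)%E.-integrable setT
    (fun z => (g (row_cons z.1 (row_of z.2)))%:E).
Proof.
move=> cg; have := integrable_torus cg; set G := fun y => _.
move=> /integrableP[mG iG].
have mGt : measurable_fun setT (G \o @tcons R n).
  exact: measurableT_comp.
rewrite (_ : (fun z => _) = G \o @tcons R n); last first.
  by apply/funext => z; rewrite /G/= row_tcons.
apply/integrableP; split=> //.
have mt : measurable_fun setT (@tcons R n) by [].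
have := @ge0_integral_pushforward _ _ _ _ R _ mt (leb01 \x tm n)%E setT
  (abse \o G) measurableT.
rewrite preimage_setT => <-//.
  by apply: measurableT_comp.
by move=> y _; exact: abse_ge0.
Qed.

Let torus_integral_tcons n (g : 'rV[R]_n.+1 -> R) : continuous g ->
  torus_integral g =
  fine (\int[(leb01 \x tm n)%E]_z (g (row_cons z.1 (row_of z.2)))%:E)%E.
Proof.
move=> cg; rewrite /torus_integral /Rintegral; congr fine.
have mt : measurable_fun setT (@tcons R n) by [].
have := @integral_pushforward _ _ _ _ R _ mt (leb01 \x tm n)%E setT
  (fun y => (g (row_of y))%:E).
rewrite preimage_setT => ->//.
- by apply: eq_integral => z _; rewrite /= row_tcons.
- by have := measurable_row cg => mg; apply/measurable_EFinP.
- have := integrable_tcons cg; congr integrable.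
  by apply/funext => z; rewrite /= row_tcons.
Qed.

(** Fubini's theorem with the first coordinate outermost, the form suited to induction on the
    dimension. *)
Lemma torus_integral_recl n (g : 'rV[R]_n.+1 -> R) : continuous g ->
  torus_integral g = \int[leb01]_s torus_integral (fun x => g (row_cons s x)).
Proof.
move=> cg; rewrite torus_integral_tcons// /Rintegral; congr fine.
rewrite -(integral12_prod_meas1 (integrable_tcons cg)).
apply: eq_integral => s _; rewrite /fubini_F/= /torus_integral /Rintegral fineK//.
apply: integrable_fin_num => //.
apply: (@integrable_torus _ (fun x => g (row_cons s x))).
exact: continuousT_comp (@continuous_row_consr n s) cg.
Qed.

(** The opposite order, which lets the fundamental theorem of calculus act in the first coordinate
    while the others are fixed. *)
Lemma torus_integral_recr n (g : 'rV[R]_n.+1 -> R) : continuous g ->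
  torus_integral g = torus_integral (fun x => \int[leb01]_s g (row_cons s x)).
Proof.
move=> cg; rewrite torus_integral_tcons// /torus_integral {2}/Rintegral; congr fine.
rewrite -(integral21_prod_meas1 (integrable_tcons cg)).
apply: eq_integral => y _; rewrite /fubini_G/= /Rintegral fineK//.
apply: integrable_fin_num => //.
apply: (@integral_lebesgue01 (fun s => g (row_cons s _)) _).1.
exact: continuousT_comp (@continuous_row_consl n _) cg.
Qed.

End torus.

(** * Plane waves *)

Section directional.
Context {R : realType}.

(** A directional derivative is an ordinary derivative along the line through [x], so the chain rule
    and the fundamental theorem of calculus in one variable apply. *)
Lemma is_derive_lineP (V W : normedModType R) (f : V -> W) (x v : V) (df : W) :
  is_derive x v f df <-> is_derive (0 : R) (1 : R) (fun h => f (h *: v + x)) df.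
Proof.
have e : (fun h : R => h^-1 *: ((f \o shift x) (h *: v) - f x)) =
    (fun h : R => h^-1 *: (((fun t : R => f (t *: v + x)) \o shift 0) (h *: 1)
                           - f (0 *: v + x))).
  by apply/funext => h /=; rewrite addr0 scale0r add0r [_%:A]mulr1.
by split => -[dfx dfe]; (apply: DeriveDef; [move: dfx|move: dfe]);
  rewrite /derivable /derive e.
Qed.

End directional.

Section waves.
Context {R : realType} {N : nat}.
Implicit Types (p q x y : 'rV[R]_N) (s t : R).

Definition dot q x : R := \sum_i q 0 i * x 0 i.

(** Real waves with a phase replace complex exponentials: phase [- (pi / 2)] gives the sine, and
    differentiation advances the phase by [pi / 2]. *)
Definition wave q t x : R := cos (2 * pi * dot q x + t).

Definition integral_row q := forall i, q 0 i \is a Num.int.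

Lemma integral_rowD p q : integral_row p -> integral_row q -> integral_row (p + q).
Proof. by move=> ip iq i; rewrite mxE rpredD. Qed.

Lemma integral_rowN q : integral_row q -> integral_row (- q).
Proof. by move=> iq i; rewrite mxE rpredN. Qed.

Lemma integral_rowB p q : integral_row p -> integral_row q -> integral_row (p - q).
Proof. by move=> ip iq; exact: integral_rowD ip (integral_rowN iq). Qed.

Lemma dotDl p q x : dot (p + q) x = dot p x + dot q x.
Proof. by rewrite /dot -big_split/=; apply: eq_bigr => i _; rewrite mxE mulrDl. Qed.

Lemma dotNl q x : dot (- q) x = - dot q x.
Proof. by rewrite /dot -sumrN; apply: eq_bigr => i _; rewrite mxE mulNr. Qed.

Lemma dotDr q x y : dot q (x + y) = dot q x + dot q y.
Proof. by rewrite /dot -big_split/=; apply: eq_bigr => i _; rewrite mxE mulrDr. Qed.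

Lemma dotNr q x : dot q (- x) = - dot q x.
Proof. by rewrite /dot -sumrN; apply: eq_bigr => i _; rewrite mxE mulrN. Qed.

Lemma dot0l x : dot 0 x = 0.
Proof. by rewrite /dot big1// => i _; rewrite mxE mul0r. Qed.

Lemma dotZr q s x : dot q (s *: x) = s * dot q x.
Proof. by rewrite /dot mulr_sumr; apply: eq_bigr => i _; rewrite mxE mulrCA. Qed.

Lemma dot_delta q i : dot q (delta_mx 0 i) = q 0 i.
Proof.
rewrite /dot (bigD1 i)//= mxE !eqxx mulr1 big1 ?addr0// => j ji.
by rewrite mxE (negbTE ji) mulr0.
Qed.

Lemma continuous_dot q : continuous (dot q).
Proof.
apply: continuous_bigsum => i; apply: continuousTM; first exact: cst_continuous.
exact: coord_continuous.
Qed.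

Lemma continuous_wave q t : continuous (wave q t).
Proof.
apply: (@continuousT_comp _ _ _ (fun x => 2 * pi * dot q x + t) cos).
  apply: continuousTD; last exact: cst_continuous.
  by apply: continuousTM; [exact: cst_continuous|exact: continuous_dot].
exact: continuous_cos.
Qed.

Lemma waveM p q s t x :
  wave p s x * wave q t x =
  2^-1 * (wave (p + q) (s + t) x + wave (p - q) (s - t) x).
Proof.
rewrite /wave dotDl dotDl dotNl.
have E (a b : R) : cos a * cos b = 2^-1 * (cos (a + b) + cos (a - b)).
  by rewrite cosD cosB; field.
by rewrite E; congr (_ * (cos _ + cos _)); ring.
Qed.

Lemma is_derive_wave q t i x :
  is_derive x (delta_mx 0 i) (wave q t) (2 * pi * q 0 i * wave q (t + pi / 2) x).
Proof.
apply/is_derive_lineP; rewrite /wave.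
rewrite (_ : (fun h => _) =
  fun h : R => cos (2 * pi * q 0 i * h + (2 * pi * dot q x + t))); last first.
  by apply/funext => h; rewrite dotDr dotZr dot_delta; congr cos; ring.
rewrite addrA cosDpihalf.
pose g (h : R) := 2 * pi * q 0 i * h + (2 * pi * dot q x + t).
have dg : is_derive (0 : R) 1 g (2 * pi * q 0 i).
  apply: is_derive_eq; rewrite /GRing.scale/=; ring.
have := @is_derive1_comp _ cos g 0 _ _ (is_derive_cos _) dg.
by move/is_derive_eq; apply; rewrite /g mulr0 add0r mulrC.
Qed.

Lemma cosDintz (a : R) (k : int) : cos (a + 2 * pi * k%:~R) = cos a.
Proof.
have pn (n : nat) b : cos (b + 2 * pi * n%:R) = cos b :> R.
  rewrite -(periodicn (@cosD2pi R) n b); congr cos.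
  by rewrite -(mulr_natr (pi *+ 2)) -(mulr_natr pi); ring.
case: k => n; first exact: pn.
by rewrite NegzE mulrNz mulrN -[LHS](pn n.+1); congr cos; rewrite -pmulrn; ring.
Qed.

Lemma wave_periodic q t i x : integral_row q ->
  wave q t (x + delta_mx 0 i) = wave q t x.
Proof.
move=> iq; have /intrP[k qk] := iq i.
rewrite /wave dotDr dot_delta qk -(cosDintz (2 * pi * dot q x + t) k).
by congr cos; ring.
Qed.

End waves.

(** * Integrals of waves and of derivatives over the torus *)

Section torus_integrals.
Context {R : realType}.

Lemma dot_row_cons n (q : 'rV[R]_n.+1) s (x : 'rV[R]_n) :
  dot q (row_cons s x) = q 0 ord0 * s + dot (\row_j q 0 (lift ord0 j)) x.
Proof.
rewrite /dot big_ord_recl row_cons0; congr (_ + _).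
by apply: eq_bigr => j _; rewrite row_consS mxE.
Qed.

(** By induction the inner integral over the other coordinates is zero unless their frequencies
    vanish; what then remains is a cosine in one variable over a whole number of periods, or a
    constant. *)
Lemma torus_integral_wave N (q : 'rV[R]_N) t : integral_row q ->
  torus_integral (wave q t) = if q == 0 then cos t else 0.
Proof.
elim: N q t => [|n IH] q t iq.
  rewrite thinmx0 eqxx -[RHS](torus_integral_cst 0%N).
  by congr torus_integral; apply/funext => x; rewrite /wave dot0l mulr0 add0r.
rewrite torus_integral_recl; last exact: continuous_wave.
set q' : 'rV_n := \row_j q 0 (lift ord0 j).
have iq' : integral_row q' by move=> i; rewrite mxE.
rewrite (_ : (fun s => _) = fun s =>
    if q' == 0 then cos (2 * pi * q 0 ord0 * s + t) else 0); last first.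
  apply/funext => s.
  rewrite (_ : (fun x => _) = wave q' (2 * pi * q 0 ord0 * s + t)).
    by rewrite IH.
  by apply/funext => x; rewrite /wave dot_row_cons; congr cos; rewrite -/q'; ring.
have q0E : (q == 0) = (q 0 ord0 == 0) && (q' == 0).
  apply/eqP/andP => [q0|[/eqP q0 /eqP q'0]].
    by split; apply/eqP; [|apply/rowP => j]; rewrite ?mxE q0 mxE.
  apply/rowP => i; rewrite mxE; case: (unliftP ord0 i) => [j ->|->//].
  by move/rowP : q'0 => /(_ j); rewrite !mxE.
rewrite q0E; case: (q' =P 0) => _; rewrite ?andbT ?andbF; last first.
  by rewrite /Rintegral integral0.
case: eqP => [->|/eqP q00].
  rewrite (_ : (fun s => _) = fun=> cos t).
    by rewrite Rintegral_cst// [X in fine X](probability_setT (@lebesgue01 R)) mulr1.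
  by apply/funext => s; rewrite mulr0 mul0r add0r.
pose c := 2 * pi * q 0 ord0.
have c0 : c != 0 by rewrite !mulf_neq0// gt_eqF// pi_gt0.
have hd (s : R) :
    is_derive s (1 : R) (fun s : R => c^-1 * sin (c * s + t)) (cos (c * s + t)).
  pose g (h : R) := c * h + t.
  have dg : is_derive s 1 g c by apply: is_derive_eq; rewrite /GRing.scale/=; ring.
  have ds := @is_derive1_comp _ sin g s _ _ (is_derive_sin _) dg.
  have := @is_deriveZ _ _ _ (sin \o g) c^-1 s 1 _ ds.
  by move/is_derive_eq; apply; rewrite /GRing.scale/= mulrCA mulVf// mulr1.
have cd : continuous (fun s : R => cos (c * s + t)).
  apply: (@continuousT_comp _ _ _ (fun s : R => c * s + t) cos);
    last exact: continuous_cos.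
  apply: continuousTD; last exact: cst_continuous.
  by apply: continuousTM; [exact: cst_continuous|move=> s; exact: cvg_id].
rewrite (lebesgue01_FTC hd cd); have /intrP[k qk] := iq ord0.
(* [c] is an integral multiple of [2 * pi], so the primitive has equal values at both ends; sines
   become shifted cosines so that [cosDintz] applies. *)
rewrite mulr0 add0r mulr1 -mulrBr -[sin (c + t)]cosBpihalf -[sin t]cosBpihalf.
have -> : c + t - pi / 2 = (t - pi / 2) + 2 * pi * k%:~R by rewrite /c qk; ring.
by rewrite cosDintz subrr mulr0.
Qed.

(** If [i] is not the first coordinate, the integral over all coordinates but the first vanishes by
    induction; if it is, integrating in it first gives the increment of [g] over a period. *)
Lemma torus_integral_derive N (i : 'I_N) (g dg : 'rV[R]_N -> R) :
  continuous g -> continuous dg ->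
  (forall x, is_derive x (delta_mx 0 i) g (dg x)) ->
  (forall x, g (x + delta_mx 0 i) = g x) -> torus_integral dg = 0.
Proof.
elim: N i g dg => [[]//|n IH] i g dg cg cdg gdg gp.
have row_consD s h (x : 'rV[R]_n) (j : 'I_n) :
    row_cons s (h *: delta_mx 0 j + x) =
    h *: delta_mx 0 (lift ord0 j) + row_cons s x.
  apply/rowP => k; case: (unliftP ord0 k) => [l ->|->].
    by rewrite row_consS !mxE liftK /= (inj_eq lift_inj).
  by rewrite row_cons0 !mxE unlift_none /= mulr0 add0r.
have row_cons0D s h (x : 'rV[R]_n) :
    row_cons (h + s) x = h *: delta_mx 0 ord0 + row_cons s x.
  apply/rowP => k; case: (unliftP ord0 k) => [l ->|->].
    by rewrite row_consS !mxE liftK /= mulr0 add0r.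
  by rewrite row_cons0 !mxE unlift_none /= ?eqxx mulr1.
case: (unliftP ord0 i) => [j|] ij; rewrite {}ij {i} in gdg gp *.
  have Z s : torus_integral (fun x => dg (row_cons s x)) = 0.
    apply: (IH j (fun x => g (row_cons s x))).
    - exact: continuousT_comp (@continuous_row_consr R n s) cg.
    - exact: continuousT_comp (@continuous_row_consr R n s) cdg.
    - move=> x; apply/is_derive_lineP.
      have := gdg (row_cons s x); move/is_derive_lineP; congr is_derive.
      by apply/funext => h; rewrite row_consD.
    - move=> x; rewrite -[in RHS]gp -[delta_mx 0 j]scale1r addrC.
      by rewrite row_consD scale1r addrC.
  rewrite torus_integral_recl//; under eq_Rintegral do rewrite Z.
  by rewrite /Rintegral integral0.
rewrite torus_integral_recr// -[RHS](torus_integral_cst n).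
congr torus_integral; apply/funext => x.
have hd (s : R) :
    is_derive s (1 : R) (fun s : R => g (row_cons s x)) (dg (row_cons s x)).
  apply/is_derive_lineP; have := gdg (row_cons s x); move/is_derive_lineP.
  congr is_derive; apply/funext => h; congr g.
  by rewrite -row_cons0D [_%:A]mulr1.
have cd : continuous (fun s : R => dg (row_cons s x)).
  exact: continuousT_comp (@continuous_row_consl R n x) cdg.
have row1 : row_cons 1 x = row_cons 0 x + delta_mx 0 ord0.
  by rewrite addrC -[delta_mx _ _]scale1r -row_cons0D addr0.
by rewrite (lebesgue01_FTC hd cd) row1 gp subrr.
Qed.

End torus_integrals.

(** * Differential operators and Fourier coefficients *)

Section matrix_derivatives.
Context {R : realType} {V : normedModType R}.

Lemma is_derive_mxP m n (F : V -> 'M[R]_(m, n)) (dF : 'M[R]_(m, n)) (x v : V) :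
  is_derive x v F dF <->
  forall i j, is_derive x v (fun y => F y i j) (dF i j).
Proof.
split=> [[Fx <-] i j|FdF].
  apply: DeriveDef; first exact: (derivable_mxP F x v).1.
  by rewrite derive_mx// mxE.
have Fx : derivable F x v by apply/derivable_mxP => i j; have [] := FdF i j.
apply: DeriveDef => //; rewrite derive_mx//; apply/matrixP => i j.
by rewrite mxE; have [] := FdF i j.
Qed.

End matrix_derivatives.

Section words.
Context {N k : nat}.
Implicit Types a : mindex N k.

(** The multi-index as a list of directions with multiplicity, since [smooth] and the rules for
    repeated derivatives are stated for lists. *)
Definition word a : seq 'I_N := flatten [seq nseq (a i) i | i <- enum 'I_N].

Lemma mpartialE (R : realType) d a (u : 'rV[R]_N -> 'rV[R]_d) :
  mpartial a u = foldr partial u (word a).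
Proof.
rewrite /mpartial /word; elim: (enum _) => //= i r ->.
by rewrite foldr_cat; elim: (nat_of_ord (a i)) => //= n ->.
Qed.

Lemma size_word a : size (word a) = mlength a.
Proof.
rewrite size_flatten /shape -map_comp sumnE big_map big_enum/=.
by apply: eq_bigr => i _; rewrite size_nseq.
Qed.

Lemma prod_word (R : realType) (c : R) (xi : 'rV[R]_N) a :
  \prod_(i <- word a) (c * xi 0 i) = c ^+ mlength a * mmonom a xi.
Proof.
rewrite big_flatten/= big_map big_enum/= /mlength -prodrXr -big_split/=.
by apply: eq_bigr => i _; rewrite big_nseq iter_mulr_1 exprMn.
Qed.

End words.

(** * Smooth periodic functions and their Fourier coefficients *)

Section smooth_functions.
Context {R : realType} {N d : nat}.
Implicit Types (u : 'rV[R]_N -> 'rV[R]_d) (q : 'rV[R]_N) (s : seq 'I_N).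

Lemma smooth_partial i u : smooth u -> smooth (partial i u).
Proof. by move=> su s; have := su (rcons s i); rewrite foldr_rcons. Qed.

Lemma smooth_continuous u : smooth u -> continuous u.
Proof. by move=> su; have [] := su [::]. Qed.

Lemma smooth_is_derive i u x : smooth u ->
  is_derive x (delta_mx 0 i) u (partial i u x).
Proof. by move=> su; apply: DeriveDef => //; have [_] := su [::]; exact. Qed.

Lemma periodic_partial i u : Defs.periodic u -> Defs.periodic (partial i u).
Proof.
move=> pu k x; rewrite /partial /derive.
set D := fun h : R => _; set D' := fun h : R => _; suff -> : D = D' by [].
by apply/funext => h; rewrite /D /D' /= addrA !pu.
Qed.

Lemma foldr_partial_wave s q t (w : 'rV[R]_d) :
  foldr partial (fun x => wave q t x *: w) s =
  fun x => (\prod_(i <- s) (2 * pi * q 0 i) *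
            wave q (t + (size s)%:R * (pi / 2)) x) *: w.
Proof.
elim: s => [|i s IH].
  by apply/funext => x /=; rewrite big_nil mul1r mul0r addr0.
rewrite /= {}IH; set c := \prod_(i <- s) _; set t' := t + _.
apply/funext => x; rewrite big_cons -/c.
have dcw : is_derive x (delta_mx 0 i) (fun x => (c * wave q t' x) *: w)
    ((c * (2 * pi * q 0 i * wave q (t' + pi / 2) x)) *: w).
  apply/is_derive_mxP => i' j; rewrite mxE.
  rewrite (_ : (fun y => _) = (w i' j * c) \*: wave q t').
    have := is_deriveZ (w i' j * c) (is_derive_wave q t' i x).
    by move/is_derive_eq; apply; rewrite /GRing.scale/=; ring.
  by apply/funext => y; rewrite /= mxE /GRing.scale/=; ring.
have [_] := dcw; rewrite /partial => ->; congr (_ *: _).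
have -> : t' + pi / 2 = t + (size s).+1%:R * (pi / 2) by rewrite /t' mulrS; ring.
by ring.
Qed.

Lemma smooth_wave q t (w : 'rV[R]_d) : smooth (fun x => wave q t x *: w).
Proof.
move=> s; rewrite foldr_partial_wave; set c := \prod_(i <- s) _; set t' := t + _.
split=> [|i x].
  apply: continuousTZ; last exact: cst_continuous.
  by apply: continuousTM; [exact: cst_continuous|exact: continuous_wave].
apply/derivable_mxP => i' j.
rewrite (_ : (fun y => _) = (w i' j * c) \*: wave q t'); last first.
  by apply/funext => y; rewrite /= mxE /GRing.scale/=; ring.
by have [] := is_deriveZ (w i' j * c) (is_derive_wave q t' i x).
Qed.

Lemma periodic_wave q t (w : 'rV[R]_d) : integral_row q ->
  Defs.periodic (fun x => wave q t x *: w).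
Proof. by move=> iq i x; rewrite wave_periodic. Qed.

Lemma apply_op_wave l (A : diffop R N d l) q t (w : 'rV[R]_d) x :
  apply_op A (fun x => wave q t x *: w) x =
  ((2 * pi) ^+ op_order A * wave q (t + (op_order A)%:R * (pi / 2)) x) *:
  (w *m symbol A q).
Proof.
rewrite /apply_op /symbol mulmx_sumr scaler_sumr; apply: eq_bigr => a /eqP la.
rewrite mpartialE foldr_partial_wave prod_word size_word la.
by rewrite -scalemxAl -scalemxAr scalerA; congr (_ *: _); ring.
Qed.

(** A real Fourier coefficient: phase [0] gives the cosine part and phase [- (pi / 2)] the sine
    part. A general phase is allowed because derivatives shift it. *)
Definition fourier_coef u q t : 'rV[R]_d :=
  \row_j torus_integral (fun x => u x 0 j * wave q t x).

Lemma continuous_coord_wave u q t j : continuous u ->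
  continuous (fun x => u x 0 j * wave q t x).
Proof.
move=> cu; apply: continuousTM; last exact: continuous_wave.
exact: continuousT_comp cu (@coord_continuous _ _ _ _ _).
Qed.

(** Integration by parts: the derivative of the product of a component of [u] with the wave has mean
    zero. The sign is absorbed by moving the phase back, since the phases [t + pi / 2] and
    [t - pi / 2] give opposite waves. *)
Lemma fourier_coef_partial i u q t :
  smooth u -> Defs.periodic u -> integral_row q ->
  fourier_coef (partial i u) q t = (2 * pi * q 0 i) *: fourier_coef u q (t - pi / 2).
Proof.
move=> su pu iq; apply/rowP => j; rewrite !mxE.
have cu := smooth_continuous su.
have cpu := smooth_continuous (smooth_partial i su).
pose c := 2 * pi * q 0 i.
have c1 := @continuous_coord_wave _ q t j cpu.
have c2 := @continuous_coord_wave _ q (t - pi / 2) j cu.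
have c3 : continuous (fun x => - c * (u x 0 j * wave q (t - pi / 2) x)).
  by apply: continuousTM; [exact: cst_continuous|exact: c2].
have : torus_integral (fun x => partial i u x 0 j * wave q t x
    + - c * (u x 0 j * wave q (t - pi / 2) x)) = 0.
  apply: (@torus_integral_derive _ _ i (fun x => u x 0 j * wave q t x)).
  - exact: continuous_coord_wave.
  - exact: continuousTD.
  - move=> x; have /is_derive_mxP/(_ 0 j) du := @smooth_is_derive i u x su.
    have dw := is_derive_wave q t i x.
    have := @is_deriveM _ _ (fun x => u x 0 j) (wave q t) x _ _ _ du dw.
    move/is_derive_eq; apply.
    have -> : wave q (t - pi / 2) x = - wave q (t + pi / 2) x.
      by rewrite /wave !addrA cosDpihalf cosBpihalf opprK.
    by rewrite /GRing.scale/= /c; ring.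
  - by move=> x; rewrite pu wave_periodic.
rewrite torus_integralD// torus_integralZ// => /eqP.
by rewrite mulNr subr_eq0 => /eqP.
Qed.

Lemma fourier_coef_foldr s u q t :
  smooth u -> Defs.periodic u -> integral_row q ->
  fourier_coef (foldr partial u s) q t =
  \prod_(i <- s) (2 * pi * q 0 i) *: fourier_coef u q (t - (size s)%:R * (pi / 2)).
Proof.
move=> su pu iq; elim: s t => [|i s IH] t.
  by rewrite big_nil scale1r mul0r subr0.
have [ss ps] : smooth (foldr partial u s) /\ Defs.periodic (foldr partial u s).
  elim: s {IH} => [|k s [IH1 IH2]]; first by split.
  by split; [exact: smooth_partial|exact: periodic_partial].
rewrite /= fourier_coef_partial// IH big_cons scalerA; congr (_ *: fourier_coef _ _ _).
by rewrite mulrS; ring.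
Qed.

(** Taking the Fourier coefficient of the equation turns each derivative of order [k] into the
    factor [(2 * pi) ^+ k] times a monomial in [q]; the nonzero constant is then cancelled. *)
Lemma fourier_coef_ker l (A : diffop R N d l) u q t :
  smooth u -> Defs.periodic u -> integral_row q ->
  (forall x, apply_op A u x = 0) -> fourier_coef u q t *m symbol A q = 0.
Proof.
(* [k] derivatives move the phase back by [k] quarter turns, hence from [t'] to [t]. *)
move=> su pu iq Au0; set k := op_order A; pose t' := t + k%:R * (pi / 2).
have cp a : continuous (@mpartial N k R d a u).
  by rewrite mpartialE; have [] := su (word a).
have : \sum_(a : mindex N k | mlength a == k)
    fourier_coef (mpartial a u) q t' *m op_coef a = 0.
  apply/rowP => c; rewrite mxE summxE -[RHS](torus_integral_cst N).
  transitivity (\sum_(a : mindex N k | mlength a == k)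
    torus_integral (fun x => (mpartial a u x *m op_coef a) 0 c * wave q t' x)).
    apply: eq_bigr => a _; rewrite mxE.
    transitivity (\sum_j torus_integral
        (fun x => op_coef a j c * (mpartial a u x 0 j * wave q t' x))).
      apply: eq_bigr => j _; rewrite mxE torus_integralZ 1?mulrC//.
      exact: continuous_coord_wave.
    rewrite -torus_integral_sum => [|j].
      congr torus_integral; apply/funext => x; rewrite mxE mulr_suml.
      by apply: eq_bigr => j _; ring.
    apply: continuousTM; [exact: cst_continuous|exact: continuous_coord_wave].
  rewrite -torus_integral_sum => [|a].
    congr torus_integral; apply/funext => x; rewrite -mulr_suml -summxE.
    by rewrite -[\sum_(_ | _) _]/(apply_op A u x) Au0 mxE mul0r.
  apply: continuousTM; last exact: continuous_wave.
  under eq_fun do rewrite mxE.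
  apply: continuous_bigsum => i'; apply: continuousTM; last exact: cst_continuous.
  exact: continuousT_comp (cp a) (@coord_continuous _ _ _ _ _).
under eq_bigr => a /eqP la.
  rewrite mpartialE fourier_coef_foldr// prod_word size_word la.
  rewrite /t' addrK -scalemxAl -scalerA scalemxAr; over.
rewrite -scaler_sumr -mulmx_sumr => /eqP; rewrite scaler_eq0 => /orP[|/eqP//].
by rewrite expf_eq0 mulf_eq0 (gt_eqF (pi_gt0 R)) pnatr_eq0 andbF.
Qed.

End smooth_functions.

(** * From quasiaffine to cone affine *)

Section mean_value.
Context {R : realType} {N : nat}.
Variable q : 'rV[R]_N.
Hypotheses (iq : integral_row q) (q0 : q != 0).

Let continuous_comp_wave (g : R -> R) c r : continuous g ->
  continuous (fun y => g (c + r * wave q 0 y)).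
Proof.
apply: continuousT_comp; apply: continuousTD; first exact: cst_continuous.
by apply: continuousTM; [exact: cst_continuous|exact: continuous_wave].
Qed.

Let mean_wave : torus_integral (wave q 0) = 0.
Proof. by rewrite torus_integral_wave// (negbTE q0). Qed.

Let mean_wave_sqr : torus_integral (fun y => wave q 0 y * wave q 0 y) = 2^-1.
Proof.
under eq_fun do rewrite waveM.
rewrite torus_integralZ; last by apply: continuousTD; exact: continuous_wave.
rewrite torus_integralD; [|exact: continuous_wave..].
rewrite !torus_integral_wave; [|exact: integral_rowB|exact: integral_rowD].
have -> : (q + q == 0) = false.
  by rewrite -mulr2n -scaler_nat scaler_eq0 pnatr_eq0 (negbTE q0).
by rewrite subrr eqxx subr0 cos0 add0r mulr1.
Qed.

(** At a maximum point [c] inside the interval, let [r] be the distance to the nearer endpoint: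
    [c + r cos] stays in the interval, so the mean of [F] there cannot exceed [F c]. The maximum is
    therefore at an endpoint. *)
Lemma maximum_principle (F : R -> R) (a b : R) : continuous F ->
  (forall c r, 0 < r -> F c < torus_integral (fun y => F (c + r * wave q 0 y))) ->
  a < b -> forall t, a <= t <= b -> F t <= Num.max (F a) (F b).
Proof.
move=> cF Fmean ab.
have [c cab Fc] := EVT_max (ltW ab) (continuous_subspaceT cF).
suff Fcab : F c <= Num.max (F a) (F b).
  by move=> t tab; apply: le_trans Fcab; apply: Fc; rewrite in_itv.
move: cab; rewrite in_itv/= => /andP[ac cb].
move: ac; rewrite le_eqVlt => /predU1P[<-|ac]; first by rewrite le_max lexx.
move: cb; rewrite le_eqVlt => /predU1P[->|cb]; first by rewrite le_max lexx orbT.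
pose r := Num.min (c - a) (b - c).
have r0 : 0 < r by rewrite lt_min !subr_gt0 ac.
have [ra rb] : r <= c - a /\ r <= b - c.
  by rewrite /r !ge_min !lexx orbT.
have := Fmean c r r0; rewrite ltNge => /negP[].
rewrite -[leRHS](torus_integral_cst N); apply: le_torus_integral.
- exact: continuous_comp_wave.
- exact: cst_continuous.
move=> y _; apply: Fc; rewrite in_itv/=.
have := cos_geN1 (2 * pi * dot q y + 0); have := cos_le1 (2 * pi * dot q y + 0).
rewrite -/(wave q 0 y); set w := wave q 0 y => w1 wN1.
have h1 : r * w <= r by rewrite -[leRHS]mulr1 ler_pM2l.
have h2 : - r <= r * w by rewrite -mulrN1 ler_pM2l.
apply/andP; split; lra.
Qed.

(** On every interval the deviation of [g] from its chord vanishes: scaled by [b - a] and taken with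
    either sign [s], it is at most [e (t - a) (b - t)] by the maximum principle, and [e] is
    arbitrarily small. *)
Lemma mean_value_affine (g : R -> R) : continuous g ->
  (forall c r, g c = torus_integral (fun y => g (c + r * wave q 0 y))) ->
  forall t, g t = g 0 + t * (g 1 - g 0).
Proof.
move=> cg gmean.
(* [- e (t - a) (b - t)] is strictly convex in [t], so adding it makes the mean value
   property strict, and it vanishes at [a] and [b]. *)
have below s a b t e : a < b -> a <= t <= b -> 0 < e ->
    s * ((b - a) * g t - (b - t) * g a - (t - a) * g b) <= e * ((t - a) * (b - t)).
  move=> ab tab e0.
  pose F t := s * (b - a) * g t
    + (- s * ((b - t) * g a + (t - a) * g b) - e * ((t - a) * (b - t))).
  have cid : continuous (id : R -> R) by move=> x; exact: cvg_id.
  have cF : continuous F.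
    apply: continuousTD; first by apply: continuousTM => //; exact: cst_continuous.
    move=> x; apply: cvgB; apply: cvgMr.
      apply: cvgD; apply: cvgMl; apply: cvgB => //; [exact: cvg_cst|exact: cvg_cst].
    by apply: cvgM; apply: cvgB => //; exact: cvg_cst.
  have Fmean c r : 0 < r -> F c < torus_integral (fun y => F (c + r * wave q 0 y)).
    move=> r0; set w := wave q 0.
    (* Constant and linear coefficients in [w] of the part of [F (c + r w)] without [g]. Since [w]
       has mean zero and its square has mean 1/2, the strict gain is [e * r ^+ 2 / 2]. *)
    pose k0 := - s * ((b - c) * g a + (c - a) * g b) - e * ((c - a) * (b - c)).
    pose k1 := s * r * (g a - g b) - e * r * (b - c - (c - a)).
    have -> : (fun y => F (c + r * w y)) =
        (fun y => (s * (b - a) * g (c + r * w y) + (k0 + k1 * w y))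
                  + e * r ^+ 2 * (w y * w y)).
      by apply/funext => y; rewrite /F /k0 /k1; ring.
    have cw : continuous w by exact: continuous_wave.
    have c1 : continuous (fun y => g (c + r * w y)) by exact: continuous_comp_wave.
    have c2 : continuous (fun y => w y * w y) by exact: continuousTM.
    have c3 : continuous (fun y => k1 * w y).
      by apply: continuousTM => //; exact: cst_continuous.
    have c4 : continuous (fun y => k0 + k1 * w y).
      by apply: continuousTD => //; exact: cst_continuous.
    have c5 : continuous (fun y => s * (b - a) * g (c + r * w y)).
      by apply: continuousTM => //; exact: cst_continuous.
    rewrite torus_integralD; last 2 first.
    - exact: continuousTD.
    - by apply: continuousTM => //; exact: cst_continuous.
    rewrite torus_integralD// torus_integralD//; last exact: cst_continuous.
    rewrite !torus_integralZ// torus_integral_cst mean_wave mean_wave_sqr -gmean.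
    rewrite mulr0 addr0 /F -/k0 ltrDl.
    by rewrite mulr_gt0// mulr_gt0// exprn_gt0.
  have := maximum_principle cF Fmean ab tab.
  have -> : F a = 0 by rewrite /F; ring.
  have -> : F b = 0 by rewrite /F; ring.
  by rewrite maxxx /F => h; lra.
have below0 s a b t : a < b -> a <= t <= b ->
    s * ((b - a) * g t - (b - t) * g a - (t - a) * g b) <= 0.
  move=> ab tab; set X := s * _; set Y := (t - a) * (b - t).
  have XY e : 0 < e -> X <= e * Y by exact: below.
  have Y0 : 0 <= Y by case/andP: tab => ? ?; rewrite mulr_ge0// subr_ge0.
  apply/ler_addgt0Pr => e e0; rewrite add0r.
  apply: le_trans (XY (e / (Y + 1)) _) _.
    by rewrite divr_gt0// ltr_wpDl.
  rewrite mulrAC ler_pdivrMr ?ltr_wpDl// ler_pM2l//; lra.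
have chord a b t : a < b -> a <= t <= b ->
    (b - a) * g t = (b - t) * g a + (t - a) * g b.
  move=> ab tab; have := below0 1 a b t ab tab; have := below0 (-1) a b t ab tab.
  lra.
(* The interval from [- b] to [b] contains [0], [1] and [t]; comparing with its chord at these three
   points gives the formula. *)
move=> t; set b := `|t| + 1.
have t0 : 0 <= `|t| by [].
have tb : - b <= t <= b.
  have := lexx `|t|; rewrite {1}ler_norml => /andP[? ?]; rewrite /b; lra.
have ab : - b < b by rewrite /b; lra.
have gt := chord (- b) b t ab tb.
have g1 := chord (- b) b 1 ab ltac:(rewrite /b; lra).
have g0 := chord (- b) b 0 ab ltac:(rewrite /b; lra).
have b0 : b - - b != 0 by rewrite gt_eqF// subr_gt0.
apply: (mulfI b0); rewrite mulrDr mulrCA mulrBr gt g1 g0; ring.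
Qed.

End mean_value.

(** * Functions affine along a direction *)

Section affine_along.
Context {R : realType} {d : nat}.
Implicit Types (f : 'rV[R]_d -> R) (v w : 'rV[R]_d).

(** An equation between values of [f] rather than the existence of coefficients: it can be rewritten
    with, and for continuous [f] it passes to limits in [w]. *)
Definition affine_along f w :=
  forall v t, f (v + t *: w) = f v + t * (f (v + w) - f v).

Lemma affine_along0 f : affine_along f 0.
Proof. by move=> v t; rewrite scaler0 addr0 subrr mulr0 addr0. Qed.

Lemma affine_alongZ f w s : affine_along f w -> affine_along f (s *: w).
Proof. by move=> fw v t; rewrite scalerA !fw; ring. Qed.

Lemma affine_alongP f w : affine_along f w <->
  forall v, exists a b : R, forall t : R, f (v + t *: w) = a * t + b.
Proof.
split=> [fw v|fw v t].
  by exists (f (v + w) - f v), (f v) => t; rewrite fw; ring.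
have [a [b ft]] := fw v.
have := ft 1; rewrite scale1r => ->; have := ft 0; rewrite scale0r addr0 => ->.
by rewrite ft; ring.
Qed.

Lemma affine_along_cvg f (w_ : nat -> 'rV[R]_d) w : continuous f ->
  w_ n @[n --> \oo] --> w -> (forall n, affine_along f (w_ n)) -> affine_along f w.
Proof.
move=> cf w_w fw_ v t.
pose Phi x := f (v + t *: x) - (f v + t * (f (v + x) - f v)).
have cPhi : continuous Phi.
  have cid : continuous (id : 'rV[R]_d -> 'rV[R]_d) by move=> x; exact: cvg_id.
  apply: continuousTD.
    apply: (continuousT_comp _ cf); apply: continuousTD; first exact: cst_continuous.
    by apply: continuousTZ => //; exact: cst_continuous.
  apply: continuousTN; apply: continuousTD; first exact: cst_continuous.
  apply: continuousTM; first exact: cst_continuous.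
  apply: continuousTD; last exact: cst_continuous.
  by apply: (continuousT_comp _ cf); apply: continuousTD => //; exact: cst_continuous.
suff : Phi w = 0 by move/eqP; rewrite subr_eq0 => /eqP.
have h1 : Phi (w_ n) @[n --> \oo] --> Phi w by apply: cvg_comp w_w (cPhi w).
have h2 : Phi (w_ n) @[n --> \oo] --> (0 : R).
  rewrite (_ : (fun n => _) = fun=> 0); first exact: cvg_cst.
  by apply/funext => n; rewrite /Phi fw_ subrr.
exact: (cvg_unique _ h1 h2).
Qed.

Lemma quasiaffine_affine_along N l (A : diffop R N d l) f (q : 'rV[R]_N) w :
  quasiaffine A f -> integral_row q -> q != 0 -> w *m symbol A q = 0 ->
  affine_along f w.
Proof.
move=> [cf qf] iq q0 wq v.
have cline : continuous (fun t : R => v + t *: w).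
  apply: continuousTD; first exact: cst_continuous.
  by apply: continuousTZ; [move=> t; exact: cvg_id|exact: cst_continuous].
have := @mean_value_affine R N q iq q0 (fun t => f (v + t *: w)).
rewrite scale0r addr0 scale1r; apply.
  exact: (continuousT_comp cline).
move=> c r; rewrite (qf _ (fun y => wave q 0 y *: (r *: w))).
- congr torus_integral; apply/funext => y; congr f.
  by rewrite scalerDl scalerA [wave q 0 y * r]mulrC addrA.
- exact: smooth_wave.
- exact: periodic_wave.
- by move=> x; rewrite apply_op_wave -scalemxAl wq scaler0 scaler0.
- move=> j; transitivity ((r *: w) 0 j * torus_integral (wave q 0)).
    rewrite -torus_integralZ; last exact: continuous_wave.
    by congr torus_integral; apply/funext => y; rewrite mxE mulrC.
  by rewrite torus_integral_wave// (negbTE q0) mulr0.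
Qed.

End affine_along.

(** * Linear symbols and density of integral directions *)

Section first_order.
Context {R : realType} {N m d : nat}.

(** A multi-index of length one is a unit vector, so its monomial is a coordinate of the
    frequency. *)
Lemma symbol_linear (B : diffop R N m d) : op_order B = 1%N ->
  linear (symbol B : 'rV[R]_N -> 'M[R]_(m, d)).
Proof.
case: B => k coef /= k1; move: coef; rewrite k1 => coef c x y.
rewrite /symbol/= scaler_sumr -big_split/=; apply: eq_bigr => a /eqP la.
rewrite scalerA -scalerDl; congr (_ *: _).
have [i ai] : exists i, a i = 1%N :> nat /\ forall j, j != i -> a j = 0%N :> nat.
  have : (0 < mlength a)%N by rewrite la.
  rewrite lt0n sum_nat_eq0 negb_forall => /existsP[i /= ai0]; exists i.
  move: la; rewrite /mlength (bigD1 i)//=.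
  case: (nat_of_ord (a i)) ai0 => // -[|n] _; last by rewrite !addSn.
  move=> /eqP; rewrite add1n eqSS sum_nat_eq0 => /forallP aj; split=> // j ji.
  by have := aj j; rewrite ji => /eqP.
have mE (z : 'rV[R]_N) : mmonom a z = z 0 i.
  rewrite /mmonom (bigD1 i)//= ai.1 expr1 big1 ?mulr1// => j ji.
  by rewrite ai.2.
by rewrite !mE !mxE.
Qed.

Variable L : 'rV[R]_N -> 'M[R]_(m, d).
Hypothesis linL : linear L.

Let Llin : {linear 'rV[R]_N -> 'M[R]_(m, d)} :=
  HB.pack L (GRing.isLinear.Build R 'rV[R]_N 'M[R]_(m, d) *:%R L linL).

Lemma linear_continuous_rV : continuous L.
Proof.
rewrite (_ : L = fun x => \sum_i x 0 i *: L (delta_mx 0 i)).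
  apply: continuous_mx => i j; under eq_fun do rewrite summxE.
  apply: continuous_bigsum => k; under eq_fun do rewrite mxE.
  by apply: continuousTM; [exact: coord_continuous|exact: cst_continuous].
apply/funext => x; rewrite [x in LHS]row_sum_delta -[L]/(Llin : _ -> _) linear_sum.
by apply: eq_bigr => i _; rewrite linearZ.
Qed.

(** By linearity, [L] at a grid point is [n.+1%:R^-1] times [L] at an integral row, and being affine
    along a direction survives scaling and limits of that direction. *)
Lemma affine_along_first_order (f : 'rV[R]_d -> R) : continuous f ->
  (forall q u, integral_row q -> affine_along f (u *m L q)) ->
  forall x u, affine_along f (u *m L x).
Proof.
move=> cf fq x u.
have cuL : continuous (fun x => u *m L x).
  apply: continuous_mx => i j; under eq_fun do rewrite mxE.
  apply: continuous_bigsum => k; apply: continuousTM; first exact: cst_continuous.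
  exact: continuousT_comp linear_continuous_rV (@coord_continuous _ _ _ _ _).
apply: (@affine_along_cvg _ _ f (fun n => u *m L (floor_approx n x)) _ cf).
  by apply: cvg_comp (@cvg_floor_approx R N x) (cuL x).
move=> n; rewrite (_ : floor_approx n x =
    n.+1%:R^-1 *: (\row_i (Num.floor (x 0 i * n.+1%:R))%:~R)); last first.
  by apply/rowP => i; rewrite !mxE mulrC.
rewrite -[L]/(Llin : _ -> _) linearZ -scalemxAr; apply: affine_alongZ; apply: fq.
by move=> i; rewrite mxE; apply/intrP; eexists.
Qed.

End first_order.

(** * Trigonometric polynomials with amplitudes in the image of a linear symbol *)

Section continuity.
Context {R : realType} {d : nat}.

(** Peeling off the directions one by one writes the function as a polynomial in the [phi i] whose
    coefficients are combinations of values of [f]. *)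
Lemma affine_along_continuous_sum (T : topologicalType) (I : Type) (s : seq I)
    (phi : I -> T -> R) (w : I -> 'rV[R]_d) (f : 'rV[R]_d -> R) v :
  (forall i, continuous (phi i)) -> (forall i, affine_along f (w i)) ->
  continuous (fun x => f (v + \sum_(i <- s) phi i x *: w i)).
Proof.
move=> cphi fw; elim: s v => [|i s IH] v.
  under eq_fun do rewrite big_nil; exact: cst_continuous.
have -> : (fun x => f (v + \sum_(k <- i :: s) phi k x *: w k)) =
    (fun x => f (v + \sum_(k <- s) phi k x *: w k) + phi i x *
      (f (v + w i + \sum_(k <- s) phi k x *: w k)
       - f (v + \sum_(k <- s) phi k x *: w k))).
  apply/funext => x; rewrite big_cons [_ + \sum_(_ <- _) _]addrC addrA fw.
  by rewrite [v + w i + _]addrAC.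
by apply: continuousTD => //; apply: continuousTM => //; apply: continuousTD => //;
  exact: continuousTN.
Qed.

(** Each basis vector is a combination of cone vectors, so [x] is a combination of finitely many
    fixed cone vectors with coefficients linear in [x]. *)
Lemma cone_affine_continuous N l (A : diffop R N d l) (f : 'rV[R]_d -> R) :
  spanning A -> cone_affine A f -> continuous f.
Proof.
move=> spanA fA.
have {}spanA v : exists z : {n : nat & ('I_n -> R) * ('I_n -> 'rV[R]_d)}%type,
    (forall i, wave_cone A ((projT2 z).2 i)) /\
    v = \sum_i (projT2 z).1 i *: (projT2 z).2 i.
  have [n [c [w [wA vE]]]] := spanA v.
  by exists (existT (fun n : nat => ('I_n -> R) * ('I_n -> 'rV[R]_d))%type n (c, w)).
pose z (j : 'I_d) := projT1 (cid (spanA (delta_mx 0 j))).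
pose I := {j : 'I_d & 'I_(projT1 (z j))}.
pose phi (i : I) (x : 'rV[R]_d) := x 0 (tag i) * (projT2 (z (tag i))).1 (tagged i).
pose w (i : I) := (projT2 (z (tag i))).2 (tagged i).
have -> : f = fun x => f (0 + \sum_(i : I) phi i x *: w i).
  apply/funext => x; congr f; rewrite add0r [LHS]row_sum_delta.
  transitivity (\sum_j \sum_(k : 'I_(projT1 (z j)))
      phi (Tagged _ k) x *: w (Tagged _ k)).
    apply: eq_bigr => j _; rewrite {1}(projT2 (cid (spanA (delta_mx 0 j)))).2.
    by rewrite scaler_sumr; apply: eq_bigr => k _; rewrite scalerA.
  by rewrite sig_big_dep/=; apply: eq_bigr => -[].
apply: affine_along_continuous_sum => i.
  by apply: continuousTM; [exact: coord_continuous|exact: cst_continuous].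
apply/affine_alongP => v; apply: fA.
exact: (projT2 (cid (spanA (delta_mx 0 (tag i))))).1.
Qed.

End continuity.

Section trigonometric_polynomials.
Context {R : realType} {N m d : nat}.
Variable L : 'rV[R]_N -> 'M[R]_(m, d).
Hypothesis linL : linear L.
Implicit Types (h : 'rV[R]_d -> R) (v : 'rV[R]_d) (q x : 'rV[R]_N).

Definition image_affine h := forall x (u : 'rV[R]_m), affine_along h (u *m L x).

Definition image_invariant h x := forall (u : 'rV[R]_m) v, h (v + u *m L x) = h v.

(** For [h] affine along [w] this is the derivative of [h] in direction [w], available without
    differentiability. *)
Definition difference h (w : 'rV[R]_d) v := h (v + w) - h v.

Let L0 : L 0 = 0.
Proof. by have := linL (-1) 0 0; rewrite scaleN1r addNr scaleN1r addNr. Qed.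

Let LD x y : L (x + y) = L x + L y.
Proof. by have := linL 1 x y; rewrite !scale1r. Qed.

Let LN x : L (- x) = - L x.
Proof. by have := linL (-1) x 0; rewrite addr0 L0 addr0 !scaleN1r. Qed.

Let image_invariantD h x y : image_invariant h x -> image_invariant h y ->
  image_invariant h (x + y).
Proof. by move=> hx hy u v; rewrite LD mulmxDr addrA hy hx. Qed.

Let image_invariantN h x : image_invariant h x -> image_invariant h (- x).
Proof. by move=> hx u v; rewrite LN mulmxN -mulNmx hx. Qed.

Let continuous_difference h w : continuous h -> continuous (difference h w).
Proof.
move=> ch; apply: continuousTD; last exact: continuousTN.
apply: (continuousT_comp _ ch); apply: continuousTD; last exact: cst_continuous.
by move=> x; exact: cvg_id.
Qed.

Let image_affine_difference h w : image_affine h -> image_affine (difference h w).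
Proof. by move=> hL x u v t; rewrite /difference !(addrAC _ _ w) !hL; ring. Qed.

Let image_invariant_difference h w q : image_invariant h q ->
  image_invariant (difference h w) q.
Proof. by move=> hq u v; rewrite /difference addrAC !hq. Qed.

(* [h] is affine on the diagonals of the parallelograms in [v + Im (L q)]. *)
Let image_invariant_difference_cone h q (u0 : 'rV[R]_m) : image_affine h ->
  image_invariant (difference h (u0 *m L q)) q.
Proof.
move=> hL u v; rewrite /difference; set w := u *m L q; set w0 := u0 *m L q.
(* The diagonals from [v] to [v + w + w0] and from [v + w0] to [v + w] have the same midpoint;
   equating the two values of [h] there yields the claim. *)
have h1 := hL q (u + u0) v 2^-1; have h2 := hL q (u - u0) (v + w0) 2^-1.
rewrite mulmxDl -/w -/w0 in h1; rewrite mulmxBl -/w -/w0 in h2.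
have e1 (a b c : 'rV[R]_d) : a + b + 2^-1 *: (c - b) = a + 2^-1 *: (c + b).
  by apply/rowP => j; rewrite !mxE; field.
have e2 : v + w0 + (w - w0) = v + w by rewrite -addrA subrKC.
by rewrite e1 e2 h1 !addrA in h2; lra.
Qed.

Variables (I : Type) (q_ : I -> 'rV[R]_N) (t_ : I -> R) (w_ : I -> 'rV[R]_d).
Hypothesis iq_ : forall i, integral_row (q_ i).
Hypothesis w_L : forall i, exists u, w_ i = u *m L (q_ i).

Definition trig (s : seq I) (y : 'rV[R]_N) : 'rV[R]_d :=
  \sum_(i <- s) wave (q_ i) (t_ i) y *: w_ i.

Lemma continuous_trig s : continuous (trig s).
Proof.
apply: continuous_mx => k j; under eq_fun do rewrite summxE.
apply: continuous_bigsum => i; under eq_fun do rewrite mxE.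
by apply: continuousTM; [exact: continuous_wave|exact: cst_continuous].
Qed.

Let continuous_comp_trig h v s : continuous h -> continuous (fun y => h (v + trig s y)).
Proof.
apply: continuousT_comp.
by apply: continuousTD; [exact: cst_continuous|exact: continuous_trig].
Qed.

Let trig_cons h v i s y : image_affine h ->
  h (v + trig (i :: s) y) =
  h (v + trig s y) + wave (q_ i) (t_ i) y * difference h (w_ i) (v + trig s y).
Proof.
move=> hL; have [u wi] := w_L i.
by rewrite /trig big_cons [_ + \sum_(_ <- _) _]addrC addrA wi hL.
Qed.

(** Induction on the number of waves, with [h], [q] and [t] free because the step replaces [h] by a
    difference and [q] by [q + q_ i] and [q - q_ i]. *)
Lemma torus_integral_wave_trig h v s q t : continuous h -> image_affine h ->
  integral_row q -> q != 0 -> image_invariant h q ->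
  torus_integral (fun y => wave q t y * h (v + trig s y)) = 0.
Proof.
elim: s h q t => [|i s IH] h q t ch hL iq q0 hq.
  under eq_fun do rewrite /trig big_nil addr0 mulrC.
  rewrite torus_integralZ; last exact: continuous_wave.
  by rewrite torus_integral_wave// (negbTE q0) mulr0.
have [hqi|hqi] := pselect (image_invariant h (q_ i)).
  rewrite -[RHS](IH h q t)//; congr torus_integral; apply/funext => y.
  have [u wi] := w_L i.
  by rewrite trig_cons// /difference wi hqi subrr mulr0 addr0.
set D := difference h (w_ i).
have cD : continuous D by exact: continuous_difference.
have DL : image_affine D by exact: image_affine_difference.
have Dq : image_invariant D q by exact: image_invariant_difference.
have Dqi : image_invariant D (q_ i).
  by have [u wi] := w_L i; rewrite /D wi; exact: image_invariant_difference_cone.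
(* Were this zero, [q_ i] would be [- q], along which [h] is invariant, against the case
   assumption. *)
have qDi : q + q_ i != 0.
  apply: contra_notN hqi => /eqP; rewrite addrC => /eqP; rewrite addr_eq0 => /eqP ->.
  exact: image_invariantN.
have qBi : q - q_ i != 0.
  by apply: contra_notN hqi; rewrite subr_eq0 => /eqP <-.
have cwh q' t' h' : continuous h' ->
    continuous (fun y => wave q' t' y * h' (v + trig s y)).
  move=> ch'; apply: continuousTM; first exact: continuous_wave.
  exact: continuous_comp_trig.
have -> : (fun y => wave q t y * h (v + trig (i :: s) y)) =
    (fun y => wave q t y * h (v + trig s y) +
      2^-1 * (wave (q + q_ i) (t + t_ i) y * D (v + trig s y) +
              wave (q - q_ i) (t - t_ i) y * D (v + trig s y))).
  by apply/funext => y; rewrite trig_cons// mulrDr mulrA waveM -/D; ring.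
have c1 := cwh (q + q_ i) (t + t_ i) D cD.
have c2 := cwh (q - q_ i) (t - t_ i) D cD.
rewrite torus_integralD; [|exact: cwh|]; last first.
  by apply: continuousTM; [exact: cst_continuous|exact: continuousTD].
rewrite torus_integralZ; last exact: continuousTD.
rewrite torus_integralD// !IH ?mulr0//.
- by rewrite [0 + 0]addr0 mulr0 addr0.
- exact: integral_rowB.
- by apply: image_invariantD => //; exact: image_invariantN.
- exact: integral_rowD.
- exact: image_invariantD.
Qed.

(** Removing a wave costs the mean of that wave times [difference h (w_ i)], which is invariant
    along [q_ i], so the previous lemma makes it zero. *)
Lemma torus_integral_trig h v s : continuous h -> image_affine h ->
  torus_integral (fun y => h (v + trig s y)) = h v.
Proof.
move=> ch hL; elim: s => [|i s IH].
  under eq_fun do rewrite /trig big_nil addr0; exact: torus_integral_cst.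
under eq_fun do rewrite trig_cons//.
have cD := @continuous_difference h (w_ i) ch.
rewrite torus_integralD; [|exact: continuous_comp_trig|]; last first.
  by apply: continuousTM; [exact: continuous_wave|exact: continuous_comp_trig].
rewrite IH; have [u wi] := w_L i; have [qi0|qi0] := eqVneq (q_ i) 0.
  (* At frequency zero the previous lemma does not apply, but the amplitude [u *m L 0] is zero. *)
  under eq_fun do rewrite wi qi0 L0 mulmx0 /difference addr0 subrr mulr0.
  by rewrite torus_integral_cst addr0.
rewrite torus_integral_wave_trig ?addr0//.
- exact: image_affine_difference.
- by rewrite wi; exact: image_invariant_difference_cone.
Qed.

End trigonometric_polynomials.

(** * Fejer means *)

(** Near a zero of [D] the function [F] stays below [e] by continuity; elsewhere [D] is locally
    bounded below and a large [C] suffices. Compactness makes one [C] serve everywhere. *)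
Lemma compact_le_eps_mul {R : realType} (T : topologicalType) (K : set T)
    (F D : T -> R) (e : R) : compact K -> continuous F -> continuous D ->
  (forall x, 0 <= D x) -> (forall x, K x -> D x = 0 -> F x <= 0) -> 0 < e ->
  exists2 C, 0 <= C & forall x, K x -> F x <= e + C * D x.
Proof.
move=> cK cF cD D0 FD e0.
have cover x : K x ->
    \forall x' \near x & n \near \oo, F x' <= e + n%:R * D x'.
  move=> Kx; have [Dx0|Dx0] := eqVneq (D x) 0.
    exists ([set x' | F x' < e], setT).
      split; last exact: filterT.
      by apply: cvgr_lt (cF x) _ _; rewrite (le_lt_trans (FD _ Kx Dx0)).
    by move=> [x' n] [/= Fe _]; rewrite -[leLHS]addr0 lerD ?mulr_ge0// ltW.
  have {}Dx0 : 0 < D x by rewrite lt_neqAle eq_sym Dx0 D0.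
  (* Nearby [F] is below [F x + 1] and [D] above [D x / 2], so every [n] from the quotient of these
     bounds on works. *)
  exists ([set x' | F x' < F x + 1] `&` [set x' | D x / 2 < D x'],
          [set n | (F x + 1) / (D x / 2) <= n%:R]).
    split; last exact: nbhs_infty_ger.
    apply: filterI; first by apply: cvgr_lt (cF x) _ _; rewrite ltrDl.
    by apply: cvgr_gt (cD x) _ _; rewrite ltr_pdivrMr// ltr_pMr// ltr1n.
  move=> [x' n] [/= [/ltW F1 /ltW D2]]; rewrite ler_pdivrMr ?divr_gt0// => nF.
  rewrite (le_trans F1)// (le_trans nF)// (le_trans (ler_wpM2l _ D2))//.
  by rewrite lerDr ltW.
have := (compact_near_coveringP K).1 cK nat \oo _ eventually_filter cover.
move=> /filter_ex[n nK]; exists n%:R => // x; exact: nK.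
Qed.

Section fejer.
Context {R : realType} {N : nat}.
Implicit Types (q x y z : 'rV[R]_N).

Section kernel.
Variable n : nat.
Local Notation grid := {ffun 'I_N -> 'I_n.+1}.

Definition freq (j : grid) : 'rV[R]_N := \row_i (j i)%:R.

(* [|sum_j exp (2 pi i j.z)|^2 / #|grid|], with the square expanded. *)
Definition fejer z : R :=
  #|grid|%:R^-1 * \sum_(p : grid * grid) wave (freq p.1 - freq p.2) 0 z.

Let card_grid_gt0 : 0 < #|grid|%:R :> R.
Proof. by rewrite ltr0n card_ffun !card_ord expn_gt0. Qed.

Lemma integral_row_freq j : integral_row (freq j).
Proof. by move=> i; rewrite mxE natr_int. Qed.

Let integral_row_freqB (p : grid * grid) : integral_row (freq p.1 - freq p.2).
Proof. by apply: integral_rowB; exact: integral_row_freq. Qed.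

Lemma freq_inj : injective freq.
Proof.
move=> j l jl; apply/ffunP => i; apply/val_inj/eqP.
by rewrite -(eqr_nat R) /=; move/rowP : jl => /(_ i); rewrite !mxE => ->.
Qed.

Lemma continuous_fejer : continuous fejer.
Proof.
apply: continuousTM; first exact: cst_continuous.
by apply: continuous_bigsum => p; exact: continuous_wave.
Qed.

Lemma fejer_ge0 z : 0 <= fejer z.
Proof.
apply: mulr_ge0; first by rewrite invr_ge0 ltW.
pose c (j : grid) := cos (2 * pi * dot (freq j) z).
pose s (j : grid) := sin (2 * pi * dot (freq j) z).
rewrite (_ : \sum_p _ = (\sum_j c j) ^+ 2 + (\sum_j s j) ^+ 2).
  by rewrite addr_ge0// sqr_ge0.
rewrite -(pair_bigA _ (fun j l => wave (freq j - freq l) 0 z))/= !expr2.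
rewrite !mulr_suml -big_split/=; apply: eq_bigr => j _.
rewrite !mulr_sumr -big_split/=; apply: eq_bigr => l _.
by rewrite /wave addr0 dotDl dotNl mulrBr cosB.
Qed.

Let reflect_wave q t x y : wave q t (x - y) = wave (- q) (2 * pi * dot q x + t) y.
Proof. by rewrite /wave dotDr dotNr dotNl; congr cos; ring. Qed.

Let continuous_reflect (g : 'rV[R]_N -> R) x :
  continuous g -> continuous (fun y => g (x - y)).
Proof.
apply: continuousT_comp; apply: continuousTD; first exact: cst_continuous.
by apply: continuousTN => y; exact: cvg_id.
Qed.

Let mean_reflect_wave q x : integral_row q ->
  torus_integral (fun y => wave q 0 (x - y)) = (q == 0)%:R.
Proof.
move=> iq; under eq_fun do rewrite reflect_wave.
rewrite torus_integral_wave; last exact: integral_rowN.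
by rewrite oppr_eq0; case: eqP => // ->; rewrite dot0l mulr0 addr0 cos0.
Qed.

(** Only the pairs with equal entries have frequency zero, and there are as many of them as grid
    points. *)
Lemma torus_integral_fejer x : torus_integral (fun y => fejer (x - y)) = 1.
Proof.
rewrite torus_integralZ; last first.
  apply: (@continuous_reflect (fun z =>
    \sum_(p : grid * grid) wave (freq p.1 - freq p.2) 0 z)).
  by apply: continuous_bigsum => p; exact: continuous_wave.
rewrite torus_integral_sum => [|p]; last first.
  by apply: (@continuous_reflect (wave _ _)); exact: continuous_wave.
under eq_bigr do rewrite mean_reflect_wave// subr_eq0 (inj_eq freq_inj).
rewrite -(pair_bigA _ (fun j l => (j == l)%:R : R))/=.
under eq_bigr => j _.
  rewrite (bigD1 j)//= eqxx big1 ?addr0; first over.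
  by move=> l; rewrite eq_sym => /negbTE ->.
by rewrite sumr_const mulVf// gt_eqF.
Qed.

(* The pairs [(j, l)] of multi-indices with [j = l + e_i] are indexed by the [l]
   with [l i < n]; those with [l i = n] form a fraction [1 / n.+1] of the grid. *)
Let card_shift (i : 'I_N) :
  #|grid|%:R - #|grid|%:R / n.+1%:R <=
  \sum_(p : grid * grid) (freq p.1 - freq p.2 == delta_mx 0 i)%:R :> R.
Proof.
pose A := [set l : grid | l i == ord_max]%SET.
have AE : (#|A| * n.+1 <= #|grid|)%N.
  have -> : (#|A| * n.+1)%N = #|finset.setX A [set: 'I_n.+1]%SET|.
    by rewrite cardsX cardsT card_ord.
  (* Overwriting the coordinate [i], which is [n] throughout [A], is injective on pairs of a point
     of [A] and a new value. *)
  pose upd (p : grid * 'I_n.+1) : grid := [ffun k => if k == i then p.2 else p.1 k].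
  rewrite -(@card_in_imset _ _ upd); first exact: max_card.
  move=> [l a] [l' a']; rewrite !inE/= !andbT => /eqP li /eqP li' /ffunP e.
  have := e i; rewrite !ffunE eqxx/= => <-; congr pair; apply/ffunP => k.
  have := e k; rewrite !ffunE/=; case: eqP => [->|//].
  by rewrite li li'.
apply: (@le_trans _ _ (\sum_(l : grid) (l \notin A)%:R)).
  rewrite (eq_bigr (fun l : grid => 1 - (l \in A)%:R)); last first.
    by move=> l _; case: (l \in A); rewrite /= ?subrr ?subr0.
  rewrite big_split/= sumr_const -[X in X <= _]/(_ - _) lerD2l sumrN lerN2.
  rewrite ler_pdivlMr ?ltr0n// -natr_sum -natrM ler_nat.
  by rewrite -big_mkcond sum1_card in AE *.
rewrite -(pair_bigA _ (fun j l => (freq j - freq l == delta_mx 0 i)%:R : R))/=.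
rewrite exchange_big/=; apply: ler_sum => l _.
case: (boolP (l \in A)) => lA; first exact: sumr_ge0.
pose j : grid := [ffun k => if k == i then inord (l k).+1 else l k].
rewrite (bigD1 j)//= (_ : freq j - freq l == _); first by rewrite lerDl sumr_ge0.
apply/eqP/rowP => k; rewrite !mxE ffunE eqxx/=.
case: eqP => [->|_]; last by rewrite subrr.
rewrite inordK ?ltnS; first by rewrite -natr1 addrAC subrr add0r.
have := ltn_ord (l i); rewrite ltnS leq_eqVlt => /predU1P[e|//].
by move: lA; rewrite inE => /eqP[]; apply/val_inj.
Qed.

(** Multiplying by a wave of frequency [e] shifts the frequencies of the kernel by [e] and [- e];
    the mean therefore counts the pairs with difference [- e] or [e], and by [card_shift] each kind
    is nearly as numerous as the grid. *)
Lemma fejer_concentration x (i : 'I_N) :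
  torus_integral (fun y => (1 - wave (delta_mx 0 i) 0 (x - y)) * fejer (x - y))
    <= n.+1%:R^-1.
Proof.
set e := delta_mx 0 i.
have ie : integral_row e by move=> k; rewrite mxE natr_int.
have cK : continuous (fun y => fejer (x - y)).
  by apply: continuous_reflect; exact: continuous_fejer.
have cw q : continuous (fun y => wave q 0 (x - y)).
  by apply: (@continuous_reflect (wave q 0)); exact: continuous_wave.
have -> : (fun y => (1 - wave e 0 (x - y)) * fejer (x - y)) =
    (fun y => fejer (x - y) + - #|grid|%:R^-1 * \sum_(p : grid * grid)
      2^-1 * (wave (freq p.1 - freq p.2 + e) 0 (x - y) +
              wave (freq p.1 - freq p.2 - e) 0 (x - y))).
  apply/funext => y; rewrite mulrBl mul1r; congr (_ + _).
  rewrite mulrC /fejer mulNr -mulrA; congr (- (_ * _)); rewrite mulr_suml.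
  by apply: eq_bigr => p _; rewrite waveM addr0 subr0.
rewrite torus_integralD//; last first.
  apply: continuousTM; first exact: cst_continuous.
  apply: continuous_bigsum => p; apply: continuousTM; first exact: cst_continuous.
  by apply: continuousTD.
rewrite torus_integral_fejer torus_integralZ; last first.
  apply: continuous_bigsum => p; apply: continuousTM; first exact: cst_continuous.
  by apply: continuousTD.
rewrite torus_integral_sum; last first.
  by move=> p; apply: continuousTM; [exact: cst_continuous|exact: continuousTD].
under eq_bigr => p _.
  rewrite torus_integralZ; last exact: continuousTD.
  rewrite torus_integralD// !mean_reflect_wave;
    [|exact: integral_rowB|exact: integral_rowD].
  rewrite addr_eq0 subr_eq0; over.
rewrite -mulr_sumr big_split/=.
(* Exchanging the two grid points reverses the sign of their difference. *)
have -> : \sum_(p : grid * grid) (freq p.1 - freq p.2 == - e)%:R =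
    \sum_(p : grid * grid) (freq p.1 - freq p.2 == e)%:R :> R.
  rewrite -(pair_bigA _ (fun j l => (freq j - freq l == - e)%:R : R))/=.
  rewrite -(pair_bigA _ (fun j l => (freq j - freq l == e)%:R : R))/= exchange_big/=.
  apply: eq_bigr => j _; apply: eq_bigr => l _.
  by rewrite -[in RHS]eqr_opp opprB.
set S := \sum_(p : grid * grid) _.
have := card_shift i; rewrite -/e -/S => hS.
have -> : 2^-1 * (S + S) = S by field.
rewrite mulNr lerBlDr -lerBlDl -(ler_pM2l card_grid_gt0) mulrA mulfV ?gt_eqF//.
by rewrite mul1r mulrBr mulr1.
Qed.

End kernel.
End fejer.

(** * Uniform approximation by Fejer means *)

Section fejer_approximation.
Context {R : realType} {N d : nat}.
Variable psi : 'rV[R]_N -> 'rV[R]_d.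
Hypotheses (cpsi : continuous psi) (ppsi : Defs.periodic psi).

Definition fejer_mean n (x : 'rV[R]_N) : 'rV[R]_d :=
  \row_c torus_integral (fun y => psi y 0 c * fejer n (x - y)).

(** A continuous substitute for the squared distance on the torus: it vanishes exactly when the two
    points differ by an integral row. *)
Let sep (z : 'rV[R]_N * 'rV[R]_N) : R :=
  \sum_i (1 - wave (delta_mx 0 i) 0 (z.1 - z.2)).

Let wave_le1 q t (x : 'rV[R]_N) : 0 <= 1 - wave q t x.
Proof. by rewrite subr_ge0 cos_le1. Qed.

Let continuous_sub : continuous (fun z : 'rV[R]_N * 'rV[R]_N => z.1 - z.2).
Proof.
apply: continuousTD; first by move=> z; exact: cvg_fst.
by apply: continuousTN => z; exact: cvg_snd.
Qed.

Let continuous_sep : continuous sep.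
Proof.
apply: continuous_bigsum => i; apply: continuousTD; first exact: cst_continuous.
apply: continuousTN; apply: continuousT_comp continuous_sub _.
exact: continuous_wave.
Qed.

Let cos2pi_eq1 (t : R) : `|t| <= 1 -> cos (2 * pi * t) = 1 ->
  [\/ t = 0, t = 1 | t = -1].
Proof.
move=> t1 ct; have [t0|t0] := eqVneq t 0; first by constructor 1.
have [/eqP tE|tE] := eqVneq `|t| 1.
  move: tE; rewrite eqr_norml => /andP[/orP[/eqP|/eqP] -> _];
    by [constructor 2|constructor 3].
have s0 : 0 < sin (pi * `|t|).
  apply: sin_gt0_pi; rewrite mulr_gt0 ?pi_gt0 ?normr_gt0//=.
  by rewrite gtr_pMr ?pi_gt0// lt_neqAle tE.
have : cos (pi * `|t| *+ 2) = 1.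
  rewrite -ct -[in RHS]cos_norm; congr cos.
  by rewrite !normrM (ger0_norm (pi_ge0 R)) (ger0_norm (ler0n R 2)) -mulr_natl mulrA.
have := cos2Dsin2 (pi * `|t|); rewrite cos_mulr2n -mulr_natl => h1 h2.
by have : 0 < sin (pi * `|t|) ^+ 2; [rewrite exprn_gt0|lra].
Qed.

(** Points of the cube at which [sep] vanishes differ by [0], [1] or [-1] in each coordinate, and
    periodicity removes these differences one coordinate at a time. *)
Let sep_eq0 (z : 'rV[R]_N * 'rV[R]_N) : cube z.1 -> cube z.2 -> sep z = 0 ->
  psi z.1 = psi z.2.
Proof.
case: z => x y /= xc yc /eqP; rewrite psumr_eq0 => [/allP xy|i _]; last exact: wave_le1.
have {}xy i : [\/ (x - y) 0 i = 0, (x - y) 0 i = 1 | (x - y) 0 i = -1].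
  apply: cos2pi_eq1.
    have /andP[? ?] := xc i; have /andP[? ?] := yc i.
    by rewrite !mxE ler_norml; apply/andP; split; lra.
  have := xy i (mem_index_enum _); rewrite subr_eq0 /wave /= addr0 => /eqP {2}->.
  congr cos; congr (_ * _); rewrite /dot (bigD1 i)//= !mxE !eqxx mul1r.
  by rewrite big1 ?addr0// => j ji; rewrite mxE (negbTE ji) mul0r.
have shift s v : psi (v + \sum_(i <- s) (x - y) 0 i *: delta_mx 0 i) = psi v.
  elim: s v => [|i s IH] v; first by rewrite big_nil addr0.
  rewrite big_cons addrA IH; case: (xy i) => ->.
  - by rewrite scale0r addr0.
  - by rewrite scale1r ppsi.
  - by rewrite scaleN1r -[in RHS](subrK (delta_mx 0 i) v) ppsi.
by rewrite -(shift (index_enum _) y) -row_sum_delta addrC subrK.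
Qed.

(** The oscillation of [psi] is at most [e / 2 + C * sep] on the cube. Integrated against the
    kernel, of mass one, the first term gives [e / 2] and the second at most [C * N / n.+1] by
    [fejer_concentration]. *)
Lemma fejer_mean_cvg (e : R) : 0 < e ->
  exists n, forall x, cube x -> `|psi x - fejer_mean n x| <= e.
Proof.
move=> e0.
pose F (z : 'rV[R]_N * 'rV[R]_N) := `|psi z.1 - psi z.2|.
have cF : continuous F.
  apply: (@continuousT_comp _ _ _ (fun z => psi z.1 - psi z.2)
    (fun v : 'rV[R]_d => `|v|)); last exact: norm_continuous.
  apply: continuousTD; first by apply: continuousT_comp cpsi => z; exact: cvg_fst.
  by apply: continuousTN; apply: continuousT_comp cpsi => z; exact: cvg_snd.
have cK := compact_setX (@cube_compact R N) (@cube_compact R N).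
have sep_ge0 z : 0 <= sep z by apply: sumr_ge0 => i _; exact: wave_le1.
have e20 : 0 < e / 2 by rewrite divr_gt0.
have [|C C0 FC] := compact_le_eps_mul cK cF continuous_sep sep_ge0 _ e20.
  move=> [x y] [/= xc yc] s0; have /= xy := @sep_eq0 (x, y) xc yc s0.
  by rewrite /F /= xy subrr normr0.
have [n nC] : exists n, C * N%:R * n.+1%:R^-1 <= e / 2.
  have /filter_ex[n /= nC] := @nbhs_infty_ger R (C * N%:R / (e / 2)).
  exists n; rewrite ler_pdivrMr ?ltr0n// -ler_pdivrMl//.
  by rewrite mulrC (le_trans nC)// ler_nat.
exists n => x xc; apply: mx_norm_le => [|i c]; first exact: ltW.
rewrite ord1 !mxE; set K := fun y : 'rV[R]_N => fejer n (x - y).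
have cxy : continuous (fun y : 'rV[R]_N => x - y).
  apply: continuousTD; first exact: cst_continuous.
  by apply: continuousTN => y; exact: cvg_id.
have cKx : continuous K by apply: continuousT_comp cxy _; exact: continuous_fejer.
have cpsic : continuous (fun y => psi y 0 c).
  exact: continuousT_comp cpsi (@coord_continuous _ _ _ _ _).
have cw (k : 'I_N) : continuous (fun y : 'rV[R]_N =>
    (1 - wave (delta_mx 0 k) 0 (x - y)) * K y).
  apply: continuousTM => //; apply: continuousTD; first exact: cst_continuous.
  by apply: continuousTN; apply: continuousT_comp cxy _; exact: continuous_wave.
have cS : continuous (fun y : 'rV[R]_N =>
    \sum_k (1 - wave (delta_mx 0 k) 0 (x - y)) * K y).
  exact: continuous_bigsum.
have cCS : continuous (fun y : 'rV[R]_N =>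
    C * \sum_k (1 - wave (delta_mx 0 k) 0 (x - y)) * K y).
  by apply: continuousTM => //; exact: cst_continuous.
have ceK : continuous (fun y : 'rV[R]_N => e / 2 * K y).
  by apply: continuousTM => //; exact: cst_continuous.
have cB : continuous (fun y : 'rV[R]_N => e / 2 * K y +
    C * \sum_k (1 - wave (delta_mx 0 k) 0 (x - y)) * K y).
  exact: continuousTD.
have -> : psi x 0 c - torus_integral (fun y : 'rV[R]_N => psi y 0 c * K y) =
    torus_integral (fun y : 'rV[R]_N => psi x 0 c * K y + - (psi y 0 c * K y)).
  rewrite torus_integralD; last 2 first.
  - by apply: continuousTM => //; exact: cst_continuous.
  - by apply: continuousTN; exact: continuousTM.
  rewrite torus_integralZ// torus_integral_fejer mulr1 torus_integralN//.
  exact: continuousTM.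
apply: le_trans (ler_norm_torus_integral _ cB _) _.
- apply: continuousTD; last by apply: continuousTN; exact: continuousTM.
  by apply: continuousTM => //; exact: cst_continuous.
- move=> y yc; rewrite -mulrBl normrM (ger0_norm (fejer_ge0 _ _)) -mulr_suml.
  rewrite (mulrA C) -mulrDl ler_wpM2r ?fejer_ge0//.
  apply: le_trans (FC (x, y) _) => //=.
  by have := le_mx_norm (psi x - psi y) 0 c; rewrite !mxE.
rewrite (torus_integralD ceK cCS) (torus_integralZ _ cKx) (torus_integralZ _ cS).
rewrite torus_integral_fejer mulr1 torus_integral_sum//.
rewrite [leRHS](splitr e) lerD2l; apply: le_trans nC; rewrite -mulrA ler_wpM2l//.
apply: (@le_trans _ _ (\sum_(k < N) n.+1%:R^-1)).
  by apply: ler_sum => k _; exact: fejer_concentration.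
by rewrite sumr_const card_ord mulr_natl.
Qed.

Section expansion.
Variable n : nat.
Local Notation grid := {ffun 'I_N -> 'I_n.+1}.
Local Notation index := ((grid * grid) * bool)%type.

Definition fejer_freq (p : index) : 'rV[R]_N := freq p.1.1 - freq p.1.2.
(** The boolean selects the cosine or the sine term of the addition formula for [cos (a - b)]. *)
Definition fejer_phase (p : index) : R := if p.2 then - (pi / 2) else 0.
Definition fejer_amplitude (p : index) : 'rV[R]_d :=
  #|grid|%:R^-1 *: fourier_coef psi (fejer_freq p) (fejer_phase p).

(** The addition formula separates [x] from [y] in each wave of the kernel, and the integrals in [y]
    are Fourier coefficients of [psi]. *)
Lemma fejer_meanE (x : 'rV[R]_N) : fejer_mean n x =
  trig fejer_freq fejer_phase fejer_amplitude (index_enum index) x.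
Proof.
have wE (q y : 'rV[R]_N) : wave q 0 (x - y) =
    wave q 0 x * wave q 0 y + wave q (- (pi / 2)) x * wave q (- (pi / 2)) y.
  rewrite /wave !addr0 dotDr dotNr mulrBr cosB; congr (_ + _).
  by rewrite !cosBpihalf.
have cc q t c : continuous (fun y => psi y 0 c * wave q t y).
  exact: continuous_coord_wave.
have cM k (g : 'rV[R]_N -> R) : continuous g -> continuous (fun y => k * g y).
  by move=> cg; apply: continuousTM => //; exact: cst_continuous.
apply/rowP => c; rewrite mxE /trig summxE.
rewrite -(pair_bigA _ (fun p b => (wave (fejer_freq (p, b)) (fejer_phase (p, b)) x
   *: fejer_amplitude (p, b)) 0 c))/=.
under [RHS]eq_bigr do rewrite big_bool/= !mxE.
transitivity (torus_integral (fun y => \sum_(p : grid * grid)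
    (wave (freq p.1 - freq p.2) (- (pi / 2)) x * #|grid|%:R^-1 *
      (psi y 0 c * wave (freq p.1 - freq p.2) (- (pi / 2)) y) +
     wave (freq p.1 - freq p.2) 0 x * #|grid|%:R^-1 *
      (psi y 0 c * wave (freq p.1 - freq p.2) 0 y)))).
  congr torus_integral; apply/funext => y.
  rewrite /fejer mulrCA mulr_sumr mulr_sumr; apply: eq_bigr => p _.
  by rewrite wE; ring.
rewrite torus_integral_sum => [|p]; last by apply: continuousTD; exact: cM.
apply: eq_bigr => p _; rewrite torus_integralD; [|exact: cM..].
by rewrite !torus_integralZ// !mulrA.
Qed.

End expansion.

End fejer_approximation.

(** * Potentials of order one *)

Section first_order_potential.
Context {R : realType} {N d l m : nat}.
Variables (A : diffop R N d l) (B : diffop R N m d).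
Hypotheses (potAB : potential A B) (B1 : op_order B = 1%N).
Implicit Types (f : 'rV[R]_d -> R).

Let linB := symbol_linear B1.

Let symbol0 : symbol B (0 : 'rV[R]_N) = 0.
Proof. by have := linB (-1) 0 0; rewrite scaleN1r addNr scaleN1r addNr. Qed.

Let symbolBA (u : 'rV[R]_m) q : q != 0 -> u *m symbol B q *m symbol A q = 0.
Proof.
move=> q0; apply/sub_kermxP.
by rewrite -(eqmxP (potAB q0)) submxMl.
Qed.

Let quasiaffine_cone_affine f : quasiaffine A f -> cone_affine A f.
Proof.
move=> fA v w [xi /= xi0 wxi].
have fL : affine_along f w.
  have /submxP[u ->] : (w <= symbol B xi)%MS by rewrite (eqmxP (potAB xi0)).
  apply: (affine_along_first_order linB fA.1) => q u' iq.
  have [->|q0] := eqVneq q 0; first by rewrite symbol0 mulmx0; exact: affine_along0.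
  exact: quasiaffine_affine_along fA iq q0 (symbolBA _ q0).
exact: (affine_alongP _ _).1 fL v.
Qed.

Let cone_affine_image_affine f : cone_affine A f -> image_affine (symbol B) f.
Proof.
move=> fA xi u; have [->|xi0] := eqVneq xi 0.
  by rewrite symbol0 mulmx0; exact: affine_along0.
apply/affine_alongP => v; apply: fA; exists xi => //=.
by apply/sub_kermxP; exact: symbolBA.
Qed.

(** The identity holds exactly for all Fejer means of [psi]; it passes to [psi] because these
    approximate it uniformly and [f] is uniformly continuous on bounded sets. *)
Let cone_affine_quasiaffine f : continuous f -> cone_affine A f -> quasiaffine A f.
Proof.
move=> cf fA; split=> // v psi spsi ppsi Apsi psi0.
have cpsi := smooth_continuous spsi.
have fej n : torus_integral (fun y => f (v + fejer_mean psi n y)) = f v.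
  under eq_fun do rewrite fejer_meanE//.
  apply: (torus_integral_trig linB) => //; last exact: cone_affine_image_affine.
    by move=> p; apply: integral_rowB; exact: integral_row_freq.
  move=> p; set q := fejer_freq p.
  have iq : integral_row q by apply: integral_rowB; exact: integral_row_freq.
  (* The coefficient at frequency zero is a multiple of the mean of [psi]. *)
  have [q0|q0] := eqVneq q 0.
    exists 0; rewrite mul0mx /fejer_amplitude -/q q0.
    rewrite (_ : fourier_coef _ _ _ = 0) ?scaler0//; apply/rowP => c.
    rewrite !mxE -[RHS](mulr0 (cos (fejer_phase p))) -(psi0 c) -torus_integralZ.
      congr torus_integral; apply/funext => y.
      by rewrite /wave dot0l mulr0 add0r mulrC.
    exact: continuousT_comp cpsi (@coord_continuous _ _ _ _ _).
  have : (fourier_coef psi q (fejer_phase p) <= symbol B q)%MS.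
    rewrite (eqmxP (potAB q0)); apply/sub_kermxP.
    exact: fourier_coef_ker.
  by move=> /submxP[u uE]; exists (#|{ffun 'I_N -> 'I_n.+1}|%:R^-1 *: u);
    rewrite /fejer_amplitude -/q uE scalemxAl.
have [M psiM] : exists M, forall y, cube y -> `|psi y| <= M.
  have /compact_bounded[M [Mr psiM]] : compact (psi @` @cube R N).
    by apply: continuous_compact (@cube_compact R N); exact: continuous_subspaceT.
  by exists (M + 1) => y yc; apply: (psiM (M + 1)); [rewrite ltrDl|exists y].
(* Radius [M + 1] leaves room for a Fejer mean within distance one of [psi]. *)
pose K : set 'rV[R]_d := [set x | `|x| <= M + 1].
have cK : compact K.
  apply: bounded_closed_compact.
    exists (M + 1); split=> [|t Mt x /=]; first exact: num_real.
    by move/le_trans; apply; exact: ltW.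
  rewrite (_ : K = (fun x => `|x|) @^-1` [set r | r <= M + 1])//.
  apply: closed_comp; last exact: closed_le.
  by move=> x _; exact: norm_continuous.
pose F (z : 'rV[R]_d * 'rV[R]_d) := `|f (v + z.1) - f (v + z.2)|.
pose D (z : 'rV[R]_d * 'rV[R]_d) := `|z.1 - z.2|.
have cfst : continuous (@fst 'rV[R]_d 'rV[R]_d) by move=> z; exact: cvg_fst.
have csnd : continuous (@snd 'rV[R]_d 'rV[R]_d) by move=> z; exact: cvg_snd.
have cfv : continuous (fun x => f (v + x)).
  apply: (continuousT_comp _ cf); apply: continuousTD; first exact: cst_continuous.
  by move=> x; exact: cvg_id.
have cF : continuous F.
  apply: (@continuousT_comp _ _ _ (fun z => f (v + z.1) - f (v + z.2))
    (fun t : R => `|t|)); last exact: norm_continuous.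
  apply: continuousTD; first exact: (continuousT_comp cfst cfv).
  by apply: continuousTN; exact: (continuousT_comp csnd cfv).
have cD : continuous D.
  apply: (@continuousT_comp _ _ _ (fun z : 'rV[R]_d * 'rV[R]_d => z.1 - z.2)
    (fun t : 'rV[R]_d => `|t|)); last exact: norm_continuous.
  by apply: continuousTD => //; exact: continuousTN.
have cfpsi : continuous (fun y => f (v + psi y)) by exact: continuousT_comp cpsi cfv.
suff close e : 0 < e -> `|f v - torus_integral (fun y => f (v + psi y))| <= e.
  apply/eqP; rewrite -subr_eq0 -normr_le0; apply/ler_addgt0Pr => e e0.
  by rewrite add0r; exact: close.
move=> e0; have e20 : 0 < e / 2 by rewrite divr_gt0.
(* Uniform continuity of [f] on [v + K] in linear form: [FC] bounds the oscillation by [e / 2] plus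
   [C] times the distance. *)
have [||C C0 FC] := compact_le_eps_mul (compact_setX cK cK) cF cD _ _ e20.
- by move=> z; exact: normr_ge0.
- move=> z _ /eqP; rewrite normr_eq0 subr_eq0 => /eqP z12.
  by rewrite /F z12 subrr normr0.
(* The bound [1] keeps the mean in [K], and the other makes [C * delta] at most [e / 2]; [C] may be
   zero, hence [C + 1]. *)
pose delta := Num.min 1 (e / 2 / (C + 1)).
have C10 : 0 < C + 1 by rewrite ltr_wpDl.
have delta0 : 0 < delta by rewrite lt_min ltr01 divr_gt0.
have [n psin] := fejer_mean_cvg cpsi ppsi delta0.
have cpsin : continuous (fejer_mean psi n).
  rewrite (_ : fejer_mean psi n = trig (@fejer_freq R N n) (@fejer_phase R N n)
    (@fejer_amplitude R N d psi n) (index_enum _)); first exact: continuous_trig.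
  by apply/funext => x; exact: fejer_meanE.
have cfpsin : continuous (fun y => f (v + fejer_mean psi n y)).
  exact: continuousT_comp cpsin cfv.
have cN : continuous (fun y => - f (v + psi y)) by exact: continuousTN.
rewrite -(fej n) -torus_integralN// -torus_integralD//.
rewrite -[leRHS](torus_integral_cst N).
apply: ler_norm_torus_integral; [exact: continuousTD|exact: cst_continuous|].
move=> y yc; have hn := psin y yc; have hM := psiM y yc.
have d1 : delta <= 1 by rewrite /delta ge_min lexx.
have d2 : delta <= e / 2 / (C + 1) by rewrite /delta ge_min lexx orbT.
have KK : (K `*` K) (fejer_mean psi n y, psi y).
  split; rewrite /K /=; last by rewrite (le_trans hM)// lerDl.
  rewrite -[fejer_mean _ _ _](subKr (psi y)) (le_trans (ler_normB _ _))//.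
  by rewrite lerD// (le_trans hn).
apply: le_trans (FC _ KK) _; rewrite /D/= distrC.
rewrite [leRHS](splitr e) lerD2l.
apply: (@le_trans _ _ ((C + 1) * delta)).
  by rewrite ler_pM// lerDl.
by rewrite mulrC -ler_pdivlMr.
Qed.

(** The spanning property supplies the continuity that is part of the definition of a quasiaffine
    function. *)
Lemma first_order_quasiaffineP f : spanning A ->
  quasiaffine A f <-> cone_affine A f.
Proof.
move=> spanA; split; first exact: quasiaffine_cone_affine.
move=> fA; apply: cone_affine_quasiaffine => //.
exact: cone_affine_continuous spanA fA.
Qed.

End first_order_potential.

Theorem theoremB (R : realType) (N d l m : nat)
    (A : diffop R N d l) (B : diffop R N m d) (f : 'rV[R]_d -> R) :
  constant_rank A -> spanning A -> potential A B -> op_order B = 1%N ->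
  quasiaffine A f <-> cone_affine A f.
Proof. by move=> _ spanA potAB B1; exact: (first_order_quasiaffineP potAB B1). Qed.
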